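(* Let $\lambda>0$ and let $r$ be any minimizer of the modified functional $\hat I$ over $\mathcal{A}_\lambda$. Assume that there are positive constants $K,\gamma_0$ such that $$|d\,h'(cd)|\le K[h(d)+1]\qquad\text{for all } d>0 \text{ and all } c \text{ with } |c-1|\le\gamma_0.$$ Then $r$ is a solution of $$\frac{d}{dR}\left[R^{n-1}\Phi_{,1}(r(R))\right]=(n-1)R^{n-2}\Phi_{,2}(r(R)),\qquad 0<R<1,$$ where $\Phi(v_1,\dots,v_n)=\frac{\kappa}{n}\sum_{i=1}^nv_i^n+h(v_1v_2\cdots v_n)$.
   Context: $n\in\{2,3\}$ and $\kappa>0$. The function $h:(0,\infty)\to[0,\infty)$ is $C^1$ (with second derivative existing) and satisfies: $h''(d)>0$ for all $d>0$; $\lim_{d\to0^+}h(d)=\infty$; $\lim_{d\to\infty}h(d)/d=\infty$; $\lim_{d\to0^+}h'(d)=-\infty$; $\lim_{d\to\infty}h'(d)=\infty$. Admissible set: $\mathcal{A}_\lambda=\{r\in W^{1,1}(0,1): r(1)=\lambda,\ r'(R)>0\text{ for a.e. }R\in(0,1),\ r(0)\ge0\}$. Modified functional: $$\hat I(r)=\int_0^1R^{n-1}\left[\frac{\kappa}{n}(r'(R))^n+h(\delta(R))+\kappa(n-1)\delta(R)\left(\frac1n+\ln\left(\frac{r(R)}{R}\right)\right)\right]dR-\frac{\kappa(n-1)}{n}\lambda^n\ln\lambda,$$ with $\delta(R)=r'(R)\left(\frac{r(R)}{R}\right)^{n-1}$. $\Phi_{,i}$ is the partial derivative of $\Phi$ with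 respect to its $i$-th argument and $\Phi_{,i}(r(R))=\Phi_{,i}\left(r'(R),\frac{r(R)}{R},\dots,\frac{r(R)}{R}\right)$. *)

(* Defs.v *)
From HB Require Import structures.
From mathcomp Require Import all_boot all_order all_algebra.
From mathcomp Require Import all_classical all_reals all_analysis.

Set Implicit Arguments.
Unset Strict Implicit.
Unset Printing Implicit Defensive.

Import Order.TTheory GRing.Theory Num.Theory.
Import numFieldNormedType.Exports.

Local Open Scope ring_scope.
Local Open Scope classical_set_scope.

Definition C1c_test (R : realType) (phi : R -> R) : Prop :=
  [/\ forall x, derivable phi x 1,
      continuous phi^`(),
      compact (closure [set x | phi x != 0]) &
      closure [set x | phi x != 0] `<=` `]0, 1[%classic].

(* Test functions are taken in C^1_c(0,1), as in Brezis' definition of W^{1,p}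
   of an interval. *)
Definition weak_derivative (R : realType) (r g : R -> R) : Prop :=
  (@lebesgue_measure R).-integrable `]0, 1[ (EFin \o g) /\
  forall phi : R -> R, C1c_test phi ->
    \int[lebesgue_measure]_(x in `]0, 1[) (r x * phi^`()%classic x) =
    - \int[lebesgue_measure]_(x in `]0, 1[) (g x * phi x).

(* An element of W^{1,1}(0,1) is given by its representative that is continuous
   on [0,1], so that r(0) and r(1) are meaningful. *)
Definition W11 (R : realType) (r : R -> R) : Prop :=
  [/\ {within `[0, 1], continuous r},
      (@lebesgue_measure R).-integrable `]0, 1[ (EFin \o r) &
      exists g, weak_derivative r g].

(* Some weak derivative of r; it is determined by r almost everywhere. *)
Definition wderiv (R : realType) (r : R -> R) : R -> R :=
  get [set g | weak_derivative r g].

Definition admissible (R : realType) (lam : R) : set (R -> R) :=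
  [set r | [/\ W11 r,
               r 1 = lam,
               {ae lebesgue_measure, forall x : R, 0 < x < 1 -> 0 < wderiv r x} &
               0 <= r 0]].

Definition delta (R : realType) (n : nat) (r : R -> R) (x : R) : R :=
  wderiv r x * (r x / x) ^+ n.-1.

(* Extended-real valued, since an admissible r may have infinite energy. *)
Definition Ihat (R : realType) (n : nat) (kappa : R) (h : R -> R) (lam : R)
    (r : R -> R) : \bar R :=
  (\int[lebesgue_measure]_(x in `]0%R, 1%R[)
     (x ^+ n.-1 *
      (kappa / n%:R * wderiv r x ^+ n + h (delta n r x)
       + kappa * (n%:R - 1) * delta n r x * (n%:R^-1 + ln (r x / x))))%:E
   - (kappa * (n%:R - 1) / n%:R * lam ^+ n * ln lam)%:E)%E.

Definition minimizer (R : realType) (F : (R -> R) -> \bar R)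
    (A : set (R -> R)) (r : R -> R) : Prop :=
  A r /\ forall s, A s -> (F r <= F s)%E.

Definition Phi (R : realType) (n : nat) (kappa : R) (h : R -> R)
    (v : 'rV[R]_n) : R :=
  kappa / n%:R * \sum_(i < n) v 0 i ^+ n + h (\prod_(i < n) v 0 i).

(* Partial derivative with respect to the i-th argument; i is counted from 1. *)
Definition partial (R : realType) (n : nat) (F : 'rV[R]_n -> R) (i : nat)
    (v : 'rV[R]_n) : R :=
  'D_(\row_(j < n) ((j.+1 == i)%:R : R)) F v.

(* (r'(x), r(x)/x, ..., r(x)/x), with r' the classical derivative. *)
Definition radial_stretches (R : realType) (n : nat) (r : R -> R) (x : R) :
    'rV[R]_n :=
  \row_(j < n) (if j == 0%N :> nat then r^`() x else r x / x).

(* Classical solution on (0,1); r' and r must be positive for the arguments of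
   Phi to lie in its domain (0,oo)^n. *)
Definition EL_solution (R : realType) (n : nat) (kappa : R) (h : R -> R)
    (r : R -> R) : Prop :=
  forall x : R, 0 < x < 1 ->
    [/\ derivable r x 1, 0 < r^`() x, 0 < r x &
        is_derive x (1 : R)
          (fun y => y ^+ n.-1 *
             partial (Phi kappa h) 1 (radial_stretches n r y))
          ((n%:R - 1) * x ^+ n.-2 *
             partial (Phi kappa h) 2 (radial_stretches n r x))].

(* Main.v *)
(* An admissible r is the primitive of a positive integrable g, and comparison with
   x |-> lam x shows that the terms of the energy are integrable: up to a multiple
   of g they are bounded below. For bounded w vanishing on (0,a] and with
   int w g = 0, put phi(x) = int_0^x w g, and compare r with r + t phi, of slope
   g (1 + t w). On [a,1] both r and r' are thus multiplied by factors close to 1, so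
   delta is too, and the growth condition dominates the difference quotients of the
   energy. The vanishing first variation, integrated by parts (Fubini), gives
     dL/dr'(x, r, r') = C + int_a^x dL/dr   for almost every x in (a,1),
   L being the integrand of the modified functional. Its left-hand side is
   continuous and strictly increasing in r', with range the whole line, and the
   right-hand side is continuous in x, so r' has a continuous representative, r is
   C^1 and the equation can be differentiated. Since L differs from x^(n-1) Phi by a
   total derivative, the result is the equation for Phi. *)

Require Import Defs.
From HB Require Import structures.
From mathcomp Require Import all_boot all_order all_algebra.
From mathcomp Require Import all_classical all_reals all_analysis.
From mathcomp Require Import measurable_realfun ring lra.

Set Implicit Arguments.
Unset Strict Implicit.
Unset Printing Implicit Defensive.

Import Order.TTheory GRing.Theory Num.Theory.
Import numFieldNormedType.Exports.

Local Open Scope ring_scope.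
Local Open Scope classical_set_scope.

(** * Almost everywhere equality and integrals *)

(** The modification is by a null Lagrangian. On radial maps x^(n-1) Phi contains kappa (n-1)/n r^n
    / x, which is not integrable at 0 when r(0) > 0; adding the derivative of kappa (n-1)/n r^n
    ln(r/x) trades it for the logarithmic term, and the value of that function at x = 1 is the
    constant subtracted in [Ihat]. Two obstacles shape the variations. Nothing bounds r' from above
    or away from 0, so an additive smooth variation could make the slope negative or move delta by a
    factor outside the reach of the growth condition; with phi' = w g the relative change of slope
    is bounded. And r may tend to 0 at the origin, so phi / r is controlled by making phi vanish
    near 0, whence the number a. The condition on int w g keeps the value at x = 1. The constant C
    and the continuous slope are built for each a separately, which is harmless because the
    classical equation is local. The logarithmic part of dL/dr' depends on x and r only, so its
    monotonicity and range in the slope are those of x^(n-1) Phi_{,1}, where h'' > 0 and the limits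
    of h' enter. *)

Section ae_integral.
Context d (T : measurableType d) (R : realType) (mu : {measure set T -> \bar R}).
Import HBNNSimple.
Local Open Scope ereal_scope.

(** The integral of a nonnegative function is a supremum over simple functions below it. Such a
    function below [f], set to 0 on [N], lies below [g] and keeps its integral, so no measurability
    of [f] or [g] enters. *)
Lemma ge0_le_integral_off_null (f g : T -> \bar R) (N : set T) :
  measurable N -> mu N = 0 -> (forall x, 0 <= f x) -> (forall x, 0 <= g x) ->
  (forall x, ~ N x -> f x = g x) -> \int[mu]_x f x <= \int[mu]_x g x.
Proof.
move=> mN N0 f0 g0 fg; rewrite !ge0_integralTE//.
apply: ge_ereal_sup => _ [h /= hf <-].
have mCN : measurable (~` N) by exact: measurableC.
apply: le_ereal_sup_tmp; exists (sintegral mu (proj_nnsfun h mCN)).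
{ exists (proj_nnsfun h mCN) => //= x.
  rewrite mindicE; case: (boolP (x \in ~` N)) => [|_].
  { by rewrite inE => /fg <-; rewrite mulr1. }
  by rewrite mulr0. }
rewrite -!integralT_nnsfun (@ge0_ae_eq_integral _ _ _ mu _ _ (fun x => (proj_nnsfun h mCN
  x)%:E))//.
{ by apply/measurable_EFinP. }
{ by apply/measurable_EFinP. }
{ by move=> x _; rewrite lee_fin fun_ge0. }
{ by move=> x _; rewrite lee_fin fun_ge0. }
exists N; split => // x /= ; apply: contra_notP => Nx _.
by rewrite /= mindicE mem_set// mulr1.
Qed.

(* The library lemma [ae_eq_integral] asks for measurability, which the integrand
   of [Ihat] may lack: on a Borel null set [wderiv r] may leave (0,oo), where [h]
   is arbitrary. *)
Lemma ae_eq_integral_nonmeasurable (D : set T) (f g : T -> \bar R) :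
  ae_eq mu D f g -> \int[mu]_(x in D) f x = \int[mu]_(x in D) g x.
Proof.
move=> [N [mN N0 fg]].
have {}fg x : ~ N x -> (f \_ D) x = (g \_ D) x.
{ move=> Nx; rewrite !patchE; case: ifPn => // xD.
  by apply: contra_notP Nx => fgx; apply: fg => /= /(_ (set_mem xD)). }
rewrite integral_mkcond [RHS]integral_mkcond integralE [RHS]integralE.
by congr (_ - _); apply/eqP; rewrite eq_le; apply/andP; split;
  apply: (ge0_le_integral_off_null mN) => // x Nx;
  rewrite ?funeposE ?funenegE (fg _ Nx).
Qed.

End ae_integral.

(** * Primitives of integrable functions *)

Section primitive.
Context (R : realType).
Notation mu := (@lebesgue_measure R).
Implicit Types (f g : R -> R) (x : R).

Lemma ae_imply2 (P Q S : R -> Prop) : {ae mu, forall x, P x} -> {ae mu, forall x, Q x} ->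
  (forall x, P x -> Q x -> S x) -> {ae mu, forall x, S x}.
Proof.
move=> [A [mA A0 PA]] [B [mB B0 QB]] H; exists (A `|` B); split.
{ exact: measurableU. }
{ by rewrite null_set_setU. }
move=> x /= nS; apply: contrapT => /not_orP[nA nB]; apply: nS; apply: H.
{ by apply: contrapT => nP; apply: nA; apply: PA. }
{ by apply: contrapT => nP; apply: nB; apply: QB. }
Qed.

Lemma ae_imply (P Q : R -> Prop) : {ae mu, forall x, P x} ->
  (forall x, P x -> Q x) -> {ae mu, forall x, Q x}.
Proof. by move=> Pae PQ; apply: (ae_imply2 Pae Pae) => x Px _; exact: PQ. Qed.

Definition prim g x := \int[mu]_(t in `[0, x]) g t.

Lemma prim0 g : prim g 0 = 0.
Proof. by rewrite /prim set_itv1 Rintegral_set1. Qed.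

Lemma integrableT_sub f (D : set R) : measurable D ->
  mu.-integrable setT (EFin \o f) -> mu.-integrable D (EFin \o f).
Proof. by move=> mD; apply: integrableS. Qed.

Lemma within_continuous_bounded (u : R -> R) (a b : R) : a <= b ->
  {within `[a, b], continuous u} ->
  exists2 M, 0 <= M & forall x, a <= x <= b -> `|u x| <= M.
Proof.
move=> ab cu.
have cu' : {within `[a, b], continuous (fun x => `|u x|)}.
{ apply: (@within_continuous_comp _ _ _ _ u (fun y : R => `|y|)) => //.
  move=> x _; exact: norm_continuous. }
have [c cab Hc] := @EVT_max R _ a b ab cu'.
by exists `|u c| => // x xab; apply: Hc; rewrite in_itv.
Qed.

Lemma integrableM_continuous (u g : R -> R) (a b : R) : a <= b ->
  {within `[a, b], continuous u} ->
  mu.-integrable `[a, b] (EFin \o g) ->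
  mu.-integrable `[a, b] (EFin \o (fun x => u x * g x)).
Proof.
move=> ab cu ig.
have [M M0 HM] := within_continuous_bounded ab cu.
have := @integrableMr _ _ _ mu `[a, b]%classic (measurable_itv _) u (EFin \o g).
move=> /(_ _ _ ig) H.
apply: (eq_integrable _ _ _ _ (H _ _)) => //.
{ exact: subspace_continuous_measurable_fun. }
exists M; split; first exact: num_real.
move=> K MK x /=; rewrite in_itv /= => xab; apply/ltW/(le_lt_trans _ MK).
exact: HM.
Qed.

Lemma prim_continuous g : mu.-integrable setT (EFin \o g) ->
  {within `[0, 1], continuous (prim g)}.
Proof.
move=> ig; apply: (@parameterized_integral_continuous R 0 1 g) => //.
exact: integrableT_sub.
Qed.

Lemma eq_prim f g : {ae mu, forall x, 0 < x < 1 -> f x = g x} ->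
  forall x, 0 <= x <= 1 -> prim f x = prim g x.
Proof.
move=> fg x /andP[x0 x1]; rewrite /prim /Rintegral; congr fine.
apply: ae_eq_integral_nonmeasurable.
have A1 : {ae mu, forall y, y <> 0}.
{ exists [set 0]; split => //; first by rewrite lebesgue_measure_set1.
  by move=> y /= /contrapT. }
have A2 : {ae mu, forall y, y <> 1}.
{ exists [set 1]; split => //; first by rewrite lebesgue_measure_set1.
  by move=> y /= /contrapT. }
apply: (ae_imply2 fg (ae_imply2 A1 A2 (fun y p q => conj p q))) => y fgy [y0 y1] /=.
rewrite in_itv /= => /andP[y0' yx]; congr EFin; apply: fgy; rewrite !lt_neqAle y0' (le_trans yx
  x1) !andbT.
by apply/andP; split; apply/eqP => // /esym.
Qed.

Lemma prim_sub f x y : mu.-integrable setT (EFin \o f) -> 0 <= x <= y ->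
  prim f y - prim f x = \int[mu]_(t in `[x, y]) f t.
Proof.
move=> intf /andP[x0 xy]; rewrite /prim Rintegral_itvB//.
{ rewrite Rintegral_itv_obnd_cbnd//; exact: integrableT_sub. }
exact: integrableT_sub.
Qed.

(** Fubini for the kernel f(x) g(y) on the triangle 0 <= y <= x <= 1: integrating in y first gives f
    times [prim g], integrating in x first gives g(y) times [prim f 1 - prim f y]. *)
Lemma prim_by_parts f g :
  mu.-integrable setT (EFin \o f) -> mu.-integrable setT (EFin \o g) ->
  \int[mu]_(x in `[0, 1]) (f x * prim g x) +
  \int[mu]_(x in `[0, 1]) (prim f x * g x) = prim f 1 * prim g 1.
Proof.
move=> intf intg.
pose f1 : R -> R := f \_ `[0, 1]; pose g1 : R -> R := g \_ `[0, 1].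
have restr (u : R -> R) (D : set R) : measurable D -> mu.-integrable setT (EFin \o u) ->
  mu.-integrable setT (EFin \o (u \_ D)).
{ move=> mD iu; rewrite -restrict_EFin; have H := (@integrable_mkcond _ (measurableTypeR R) R
  mu D (EFin \o u) mD).1.
  by apply: H; exact: integrableT_sub. }
have if1 : mu.-integrable setT (EFin \o f1) by exact: restr.
have ig1 : mu.-integrable setT (EFin \o g1) by exact: restr.
have mf1 : measurable_fun setT f1 by apply/measurable_EFinP; exact: measurable_int if1.
have mg1 : measurable_fun setT g1 by apply/measurable_EFinP; exact: measurable_int ig1.
pose k (z : R * R) : R := f1 z.1 * g1 z.2 * (if z.2 <= z.1 then 1 else 0).
have mk : measurable_fun setT (EFin \o k).
{ apply/measurable_EFinP; apply: measurable_funM; first apply: measurable_funM.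
  { exact: (measurableT_comp mf1). }
  { exact: (measurableT_comp mg1). }
  apply: measurable_fun_ifT => //.
  exact: measurable_fun_ler. }
(* By Tonelli the kernel is dominated by the product of the L^1 norms of [f1] and [g1]. *)
have ik : (mu \x mu)%E.-integrable setT (EFin \o k).
{ apply/integrable12ltyP => //=.
  have /integrableP[_ f1oo] := if1; have /integrableP[_ g1oo] := ig1.
  apply: (@le_lt_trans _ _ (\int[mu]_x (`|(f1 x)%:E| * \int[mu]_y `|(g1 y)%:E|))%E).
  { apply: ge0_le_integral => //.
    { by move=> x _; apply: integral_ge0. }
    { apply: (@measurable_fun_fubini_tonelli_F _ _ (measurableTypeR R) (measurableTypeR R) R mu
      (abse \o (EFin \o k))) => //=.
      exact: measurableT_comp. }
    { apply: emeasurable_funM => //; do 2 apply: measurableT_comp => //. }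
    move=> x _; rewrite -ge0_integralZl//.
    { apply: ge0_le_integral => //.
      { do 2 apply: measurableT_comp => //.
        by apply/measurable_EFinP; exact: (measurableT_comp mk (pair1_measurable x)). }
      { apply: emeasurable_funM => //; do 2 apply: measurableT_comp => //. }
      move=> y _; rewrite -EFinM lee_fin /k /= !normrM.
      by case: ifP => _; rewrite ?normr1 ?normr0 ?mulr1 ?mulr0 // mulr_ge0. }
    { by do 2 apply: measurableT_comp => //. } }
  rewrite ge0_integralZr//; last exact: integral_ge0.
  { by rewrite lte_mul_pinfty// ?integral_ge0// ge0_fin_numE// integral_ge0. }
  by do 2 apply: measurableT_comp => //. }
have k1 x : (\int[mu]_y (k (x, y))%:E = (f1 x * prim g x)%:E)%E.
{ transitivity (\int[mu]_y ((f1 x)%:E * (EFin \o (g \_ `[0%R, x])) y))%E.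
  { apply: eq_integral => y _; rewrite -EFinM /k /f1 /g1 /= !patchE !mem_setE !in_itv /=; congr
    EFin.
    case: (lerP y x) => yx; rewrite ?andbT ?andbF ?mulr0 ?mulr1 //.
    case: ifPn => [/andP[x0 x1]|]; rewrite ?mul0r//.
    by rewrite (le_trans yx x1) andbT. }
  rewrite integralZl//; last exact: restr.
  rewrite EFinM; congr (_ * _)%E; rewrite -restrict_EFin -integral_mkcond.
  by rewrite /prim /Rintegral fineK//; apply: integrable_fin_num => //; exact: integrableT_sub. }
have k2 y : (\int[mu]_x (k (x, y))%:E = (g1 y * \int[mu]_(t in `[y, 1]) f t)%:E)%E.
{ transitivity (\int[mu]_x ((g1 y)%:E * (EFin \o (f \_ `[y, 1%R])) x))%E.
  { apply: eq_integral => x _; rewrite -EFinM /k /f1 /g1 /= !patchE !mem_setE !in_itv /=; congr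
    EFin.
    case: (lerP y x) => yx; rewrite ?mulr0 ?mulr1 //=; rewrite mulrC.
    case: ifPn => [/andP[x0 x1]|]; rewrite ?mul0r//.
    by rewrite (le_trans x0 yx). }
  rewrite integralZl//; last exact: restr.
  rewrite EFinM; congr (_ * _)%E; rewrite -restrict_EFin -integral_mkcond.
  by rewrite /Rintegral fineK//; apply: integrable_fin_num => //; exact: integrableT_sub. }
have H : (\int[mu]_x (f1 x * prim g x)%:E = \int[mu]_y (g1 y * \int[mu]_(t in `[y, 1]) f t)%:E)%E.
{ transitivity (\int[mu]_x \int[mu]_y (k (x, y))%:E)%E.
  { by apply: eq_integral => x _; rewrite k1. }
  rewrite (Fubini ik); apply: eq_integral => y _; exact: k2. }
have cpf := prim_continuous intf.
have J1 : \int[mu]_(x in `[0, 1]) (f x * prim g x) = fine (\int[mu]_x (f1 x * prim g x)%:E)%E.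
{ rewrite Rintegral_mkcond /Rintegral; congr fine; apply: eq_integral => x _.
  by rewrite /f1 !patchE; case: ifP; rewrite ?mul0r. }
rewrite J1 H.
have -> : fine (\int[mu]_y (g1 y * \int[mu]_(t in `[y, 1]) f t)%:E)%E =
  \int[mu]_(y in `[0, 1]) (g y * prim f 1 - prim f y * g y).
{ rewrite [RHS]Rintegral_mkcond /Rintegral; congr fine; apply: eq_integral => y _.
  rewrite /g1 !patchE; case: ifPn => yI; last by rewrite mul0r.
  rewrite -[fine _]/(\int[mu]_(t in `[y, 1]) f t) -prim_sub//; first by congr EFin; ring.
  by move: yI; rewrite inE /= in_itv. }
rewrite RintegralB//.
{ rewrite RintegralZr//; last exact: integrableT_sub.
  by rewrite subrK mulrC. }
{ apply: (@integrableZr _ _ _ mu _ _ (prim f 1) (EFin \o g)) => //; exact: integrableT_sub. }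
apply: integrableM_continuous => //; exact: integrableT_sub.
Qed.

End primitive.

(** * Integrability of real-valued functions *)

Section integrable_EFin_theory.
Context d (T : measurableType d) (R : realType) (mu : {measure set T -> \bar R}).
Variables (D : set T) (mD : measurable D).
Implicit Types f g : T -> R.

Lemma integrableD_EFin f g : mu.-integrable D (EFin \o f) -> mu.-integrable D (EFin \o g) ->
  mu.-integrable D (EFin \o (fun x => f x + g x)).
Proof. by move=> fi gi; exact: (integrableD mD fi gi). Qed.

Lemma integrableB_EFin f g : mu.-integrable D (EFin \o f) -> mu.-integrable D (EFin \o g) ->
  mu.-integrable D (EFin \o (fun x => f x - g x)).
Proof. by move=> fi gi; exact: (integrableB mD fi gi). Qed.

Lemma integrableZl_EFin k f : mu.-integrable D (EFin \o f) ->
  mu.-integrable D (EFin \o (fun x => k * f x)).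
Proof. by move=> fi; exact: (integrableZl mD k fi). Qed.

Lemma integrableZr_EFin k f : mu.-integrable D (EFin \o f) ->
  mu.-integrable D (EFin \o (fun x => f x * k)).
Proof. by move=> fi; exact: (integrableZr mD k fi). Qed.

Lemma eq_integrable_EFin f g : (forall x, D x -> f x = g x) -> mu.-integrable D (EFin \o f) ->
  mu.-integrable D (EFin \o g).
Proof.
move=> fg; apply: eq_integrable => // x; rewrite inE => Dx /=; by rewrite fg.
Qed.

Lemma le_integrable_EFin f g : measurable_fun D f -> mu.-integrable D (EFin \o g) ->
  (forall x, D x -> `|f x| <= g x) -> mu.-integrable D (EFin \o f).
Proof.
move=> mf gi fg; apply: (le_integrable mD _ _ gi); first exact/measurable_EFinP.
move=> x Dx /=; rewrite lee_fin (le_trans (fg _ Dx))//; exact: ler_norm.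
Qed.

Lemma integrable_EFin_measurable f : mu.-integrable D (EFin \o f) -> measurable_fun D f.
Proof. by move=> /measurable_int /measurable_EFinP. Qed.

Lemma integrableM_bounded (M : R) f g : measurable_fun D f -> mu.-integrable D (EFin \o g) ->
  (forall x, D x -> `|f x| <= M) -> mu.-integrable D (EFin \o (fun x => f x * g x)).
Proof.
move=> mf gi fM; apply: (@le_integrable_EFin _ (fun x => M * `|g x|)).
{ exact: measurable_funM (integrable_EFin_measurable gi). }
{ apply: integrableZl_EFin; exact: integrable_norm. }
by move=> x Dx; rewrite normrM ler_wpM2r// fM.
Qed.

End integrable_EFin_theory.

(** * Weak derivatives on (0,1) *)

Section weak.
Context (R : realType).
Notation mu := (@lebesgue_measure R).
Implicit Types (f g : R -> R) (x : R).

(** A C^1 primitive of the positive part; its second differences supply explicit test functions. *)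
Definition ramp2 (x : R) : R := Num.max 0 x ^+ 2 / 2.

(** The remainder [ramp2 z - ramp2 x - Num.max 0 x * (z - x)] is at most (z - x)^2 in absolute
    value, whatever the signs of x and z, so the difference quotient extends continuously to x. *)
Lemma is_derive_ramp2 (x : R) : is_derive x (1 : R) ramp2 (Num.max 0 x).
Proof.
apply/is_derive1_caratheodory.
exists (fun z => if z == x then Num.max 0 x else (ramp2 z - ramp2 x) / (z - x)); split.
{ move=> z; case: eqVneq => [->|zx]; first by rewrite !subrr mulr0.
  by rewrite divfK// subr_eq0. }
{ apply/cvgrPdist_le => /= e e0; near=> z.
  rewrite eqxx; case: eqVneq => [_|zx]; first by rewrite subrr normr0 ltW.
  have zxe : `|z - x| <= e by rewrite distrC; near: z; apply: cvgr_dist_le => //; exact: cvg_id.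
  apply: le_trans zxe; rewrite -subr_eq0 in zx.
  rewrite -(@ler_pM2r _ `|z - x|) ?normr_gt0// -normrM mulrBl divfK// -normrM /ramp2.
  have n0 : 0 <= (z - x) * (z - x) by rewrite -expr2 sqr_ge0.
  rewrite (ger0_norm n0) ler_norml.
  case: (lerP 0 x) => x0; case: (lerP 0 z) => z0;
   rewrite ?(max_r x0) ?(max_r z0) ?(max_l (ltW x0)) ?(max_l (ltW z0)); apply/andP; split; nra. }
by rewrite eqxx.
Unshelve. all: by end_near. Qed.

(** The hat of height e supported on [a - e, a + e], written as a second difference of the positive
    part so that the same second difference of [ramp2] is a primitive of it. *)
Definition tent (a e x : R) : R :=
  Num.max 0 (x - a + e) - 2 * Num.max 0 (x - a) + Num.max 0 (x - a - e).
Definition tent_prim (a e x : R) : R :=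
  ramp2 (x - a + e) - 2 * ramp2 (x - a) + ramp2 (x - a - e).

Lemma is_derive_tent_prim a e x : is_derive x (1 : R) (tent_prim a e) (tent a e x).
Proof.
have S (c : R) : is_derive x (1 : R) (fun y => ramp2 (y - a + c)) (Num.max 0 (x - a + c)).
{ have := @is_derive1_comp R ramp2 (fun y => y - a + c) x _ 1 (is_derive_ramp2 _).
  rewrite mulr1; apply.
  have := is_deriveD (is_deriveB (is_derive_id x (1:R)) (is_derive_cst a x (1:R)))
    (is_derive_cst c x (1:R)).
  by rewrite subr0 addr0. }
have S0 := S 0; have S1 := S e; have S2 := S (- e).
have := is_deriveD (is_deriveB S1 (is_deriveZ 2 S0)) S2.
have -> : (fun y => ramp2 (y - a + 0)) = (fun y => ramp2 (y - a)).
{ by apply/funext => y; rewrite addr0. }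
by rewrite addr0.
Qed.

Lemma tent_ge0 a e x : 0 < e -> 0 <= tent a e x.
Proof.
move=> e0; rewrite /tent.
case: (lerP 0 (x - a + e)) => h1; case: (lerP 0 (x - a)) => h2; case: (lerP 0 (x - a - e)) =>
  h3; lra.
Qed.

Lemma tent_gt0 a e x : 0 < e -> `|x - a| < e -> 0 < tent a e x.
Proof.
move=> e0; rewrite ltr_norml => /andP[xa1 xa2]; rewrite /tent.
case: (lerP 0 (x - a + e)) => h1; case: (lerP 0 (x - a)) => h2; case: (lerP 0 (x - a - e)) =>
  h3; lra.
Qed.

Lemma tent_eq0 a e x : 0 < e -> e <= `|x - a| -> tent a e x = 0.
Proof.
move=> e0; rewrite ler_normr => /orP[] xa1; rewrite /tent;
case: (lerP 0 (x - a + e)) => h1; case: (lerP 0 (x - a)) => h2; case: (lerP 0 (x - a - e)) =>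
  h3; lra.
Qed.

Lemma tent_prim_left a e x : 0 < e -> x <= a - e -> tent_prim a e x = 0.
Proof.
move=> e0 xa; rewrite /tent_prim /ramp2 !max_l; [|lra..].
by rewrite expr0n /= !mul0r mulr0 subr0 addr0.
Qed.

Lemma tent_prim_right a e x : 0 < e -> a + e <= x -> tent_prim a e x = e ^+ 2.
Proof. by move=> e0 xa; rewrite /tent_prim /ramp2 !max_r; [field|lra..]. Qed.

Lemma continuous_tent a e : continuous (tent a e).
Proof.
have S (c : R) : continuous (fun x : R => Num.max 0 (x - a + c)).
{ move=> x; apply/cvgrPdist_le => /= d d0; near=> z.
  have : `|x - z| <= d by near: z; apply: cvgr_dist_le => //; exact: cvg_id.
  apply: le_trans.
  case: (lerP 0 (x - a + c)) => h1; case: (lerP 0 (z - a + c)) => h2;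
    case: (lerP x z) => h3; rewrite ler_norml; lra. }
move=> x; apply: cvgD; last exact: (S (- e)).
apply: cvgB; first exact: S.
apply: cvgM; first exact: cvg_cst.
have := S 0 x; rewrite /continuous_at /=.
under eq_fun do rewrite addr0.
by rewrite addr0.
Unshelve. all: by end_near. Qed.

(** Each [tent_prim] climbs from 0 to e^2, so their difference is back at 0 beyond b + e and has
    compact support. Its derivative is a hat at a minus an equal hat at b, which compares the values
    of a function near a and near b. *)
Lemma C1c_tent (a b e : R) : 0 < e -> 0 < a - e -> a + e <= b - e -> b + e < 1 ->
  C1c_test (fun x => tent_prim a e x - tent_prim b e x) /\
  (fun x => tent_prim a e x - tent_prim b e x)^`() = (fun x => tent a e x - tent b e x).
Proof.
move=> e0 ae ab be.
have D x := is_deriveB (is_derive_tent_prim a e x) (is_derive_tent_prim b e x).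
have E : (fun x => tent_prim a e x - tent_prim b e x)^`() = (fun x => tent a e x - tent b e x).
{ by apply/funext => x; rewrite derive1E; exact: (@derive_val _ _ _ _ _ _ _ (D x)). }
have sub : closure [set x | tent_prim a e x - tent_prim b e x != 0] `<=` `[a - e, b + e].
{ have cI : closed `[a - e, b + e]%classic by exact: interval_closed.
  rewrite [X in _ `<=` X](closure_id _).1//.
  apply: closure_subset => x /=; apply: contraNP => /negP; rewrite in_itv /= negb_and -!ltNge
    => /orP[xa|xb].
  { by rewrite !tent_prim_left ?subrr//; lra. }
  by rewrite !tent_prim_right ?subrr//; lra. }
split => //; split.
{ by move=> x; exact: (@ex_derive _ _ _ _ _ _ _ (D x)). }
{ rewrite E => x; apply: cvgB; exact: continuous_tent. }
{ apply: (subclosed_compact _ (segment_compact (a := a - e) (b := b + e))) => //.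
  exact: closed_closure. }
apply: (subset_trans sub) => x /=; rewrite !in_itv /=; lra.
Qed.

Lemma Rintegral_oo_cc (a b : R) f : \int[mu]_(x in `]a, b[) f x = \int[mu]_(x in `[a, b]) f x.
Proof.
rewrite [LHS]Rintegral_mkcond [RHS]Rintegral_mkcond /Rintegral; congr fine.
apply: ae_eq_integral_nonmeasurable.
exists [set a; b]; split.
{ exact: measurableU. }
{ by rewrite null_set_setU //; exact: lebesgue_measure_set1. }
move=> x /= nx; apply: contrapT => /not_orP[xa xb]; apply: nx => _; congr EFin.
rewrite !patchE !mem_setE !in_itv /= !lt_neqAle; congr (if _ then _ else _).
have -> : a != x by apply/eqP => /esym.
by have -> : x != b by apply/eqP.
Qed.

Lemma C1c_continuous (phi : R -> R) : C1c_test phi -> continuous phi.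
Proof.
by move=> [d _ _ _] x; apply/differentiable_continuous/derivable1_diffP.
Qed.

Lemma C1c_out (phi : R -> R) x : C1c_test phi -> ~ (0 < x < 1) -> phi x = 0.
Proof.
move=> [_ _ _ s] nx; apply: contrapT => /eqP px; apply: nx.
have : closure [set x | phi x != 0] x by apply: subset_closure.
by move=> /s /=; rewrite in_itv.
Qed.

Lemma C1c_prim (phi : R -> R) x : C1c_test phi -> 0 <= x <= 1 -> prim phi^`()%classic x = phi x.
Proof.
move=> pc /andP[x0 x1]; have cp := C1c_continuous pc; have [dp cdp _ _] := pc.
have p0 : phi 0 = 0 by apply: C1c_out => //; rewrite ltxx.
move: x0; rewrite le_eqVlt => /predU1P[<-|x0]; first by rewrite prim0.
have E : (\int[mu]_(t in `[0%R, x]) (phi^`()%classic t)%:E = (phi x)%:E - (phi 0)%:E)%E.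
{ apply: continuous_FTC2; [exact: x0|exact: continuous_subspaceT| |by move=> ? _].
  split.
  { by move=> y _; exact: dp. }
  { exact/cvg_at_right_filter/cp. }
  { exact/cvg_at_left_filter/cp. } }
by rewrite /prim /Rintegral E p0 sube0.
Qed.

Lemma Rintegral0_ae (D : set R) f : measurable D -> mu.-integrable D (EFin \o f) ->
  (forall x, D x -> 0 <= f x) -> \int[mu]_(x in D) f x = 0 ->
  {ae mu, forall x, D x -> f x = 0}.
Proof.
move=> mD fi f0 If.
have mf : measurable_fun D (EFin \o f) by exact: measurable_int fi.
have := (ae_eq_integral_abs mu mD mf).1.
have -> : (\int[mu]_(x in D) `|(EFin \o f) x| = 0)%E.
{ transitivity (\int[mu]_(x in D) (EFin \o f) x)%E.
  { by apply: eq_integral => x; rewrite inE => Dx; rewrite gee0_abs//= lee_fin f0. }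
  rewrite -[LHS]fineK; last exact: integrable_fin_num.
  by rewrite -[fine _]/(\int[mu]_(x in D) f x) If. }
move=> /(_ erefl) H; apply: (ae_imply H) => x Hx Dx.
by have /= := Hx Dx => -[].
Qed.

Lemma not_ae_itv (a b : R) : a < b -> ~ {ae mu, forall x, ~ (a < x < b)}.
Proof.
move=> ab [N [mN N0 sN]].
have : mu `]a, b[ = 0.
{ apply: (subset_measure0 _ mN _ N0) => // x /=; rewrite in_itv /= => xab.
  by apply: sN => /=; apply. }
rewrite lebesgue_measure_itv /= lte_fin ab -EFinB => -[] /eqP; rewrite subr_eq0 => /eqP E.
by rewrite E ltxx in ab.
Qed.

Lemma continuous_integrable_itv (a b : R) f : {within `[a, b], continuous f} ->
  mu.-integrable `[a, b] (EFin \o f).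
Proof. by move=> cf; apply: continuous_compact_integrable => //; exact: segment_compact. Qed.

Lemma continuous_integrable_itvoo (a b : R) f : {within `[a, b], continuous f} ->
  mu.-integrable `]a, b[ (EFin \o f).
Proof.
move=> /continuous_integrable_itv; apply: integrableS => //.
exact: subset_itv_oo_cc.
Qed.

Lemma within_interior_continuous (a b x : R) f : {within `[a, b], continuous f} ->
  a < x < b -> {for x, continuous f}.
Proof.
move=> cf /andP[ax xb].
have ab : a < b by exact: lt_trans xb.
have [H _ _] := (continuous_within_itvP _ ab).1 cf.
by apply: H; rewrite in_itv /= ax xb.
Qed.

(** If w(a) < c < w(b), then (c - w) times (hat at a minus hat at b) is nonnegative for narrow hats.
    Its integral vanishes, since the hats have equal mass and w annihilates derivatives of test
    functions; but it is positive near a. *)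
Let du_bois_reymond_lt (w : R -> R) a b : {within `[0, 1], continuous w} ->
  (forall phi, C1c_test phi -> \int[mu]_(x in `]0, 1[) (w x * phi^`()%classic x) = 0) ->
  0 < a -> a < b -> b < 1 -> ~ (w a < w b).
Proof.
move=> cw H a0 ab b1 wab.
pose c := (w a + w b) / 2.
have wac : w a < c by rewrite /c; lra.
have wcb : c < w b by rewrite /c; lra.
have ca : {for a, continuous w} by apply: (within_interior_continuous cw); rewrite a0 (lt_trans
  ab).
have cb : {for b, continuous w} by apply: (within_interior_continuous cw); rewrite b1 (lt_trans
  a0).
have [d1 /= d10 D1] : nbhs a (fun x => w x < c) by exact: (cvgr_lt (w a) ca).
have [d2 /= d20 D2] : nbhs b (fun x => c < w x) by exact: (cvgr_gt (w b) cb).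
(* The width keeps w on the right side of c on each hat, the two supports non-overlapping, and both
   inside (0,1). *)
have [e [[e0 ed1 ed2] [ea eab eb]]] : exists e, [/\ 0 < e, e <= d1 & e <= d2] /\ [/\ e <= a /
  2, e <= (b - a) / 2 & e <= (1 - b) / 2].
{ exists (Num.min d1 (Num.min d2 (Num.min (a / 2) (Num.min ((b - a) / 2) ((1 - b) / 2))))).
  by do ?split; rewrite ?lt_min ?ge_min ?lexx ?orbT //; do ?(apply/andP; split); lra. }
have [|||C E] := @C1c_tent a b e e0; [lra..|].
set phi := (fun x => _) in C; rewrite -/phi in E.
have ct : {within `[0, 1], continuous (fun x => tent a e x - tent b e x)}.
{ apply: continuous_subspaceT => x; apply: cvgB; exact: continuous_tent. }
have I0 : \int[mu]_(x in `]0, 1[) (tent a e x - tent b e x) = 0.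
{ rewrite Rintegral_oo_cc -E; have := C1c_prim C (x := 1); rewrite /prim => ->; last by rewrite
  ler01 lexx.
  by apply: (C1c_out C); rewrite ltxx andbF. }
have I1 := H _ C; rewrite E in I1.
pose u x := c * (tent a e x - tent b e x) - w x * (tent a e x - tent b e x).
have i1 : mu.-integrable `]0, 1[ (EFin \o (fun x => c * (tent a e x - tent b e x))).
{ by apply: integrableZl_EFin => //; apply: continuous_integrable_itvoo. }
have i2 : mu.-integrable `]0, 1[ (EFin \o (fun x => w x * (tent a e x - tent b e x))).
{ apply: continuous_integrable_itvoo => x; apply: cvgM; [exact: cw|exact: ct]. }
have : {ae mu, forall x, `]0, 1[%classic x -> u x = 0}.
{ apply: Rintegral0_ae => //.
  { exact: integrableB_EFin. }
  { move=> x _; rewrite /u -mulrBl.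
    case: (ltrP `|x - a| e) => xa.
    { have xb : e <= `|x - b| by move: xa; rewrite ltr_norml ler_normr => /andP[? ?];
      apply/orP; right; lra.
      rewrite (tent_eq0 e0 xb) subr0 mulr_ge0 ?tent_ge0// subr_ge0 ltW//; apply: D1 => /=.
      by rewrite distrC (lt_le_trans xa). }
    rewrite (tent_eq0 e0 xa) sub0r mulrN -mulNr opprB.
    case: (ltrP `|x - b| e) => xb; last by rewrite (tent_eq0 e0 xb) mulr0.
    rewrite mulr_ge0 ?tent_ge0// subr_ge0 ltW//; apply: D2 => /=.
    by rewrite distrC (lt_le_trans xb). }
  by rewrite /u RintegralB// I1 RintegralZl// ?I0 ?mulr0 ?subr0//; apply:
    continuous_integrable_itvoo. }
move=> Hu; have aea : a - e < a + e by lra.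
apply: (not_ae_itv aea); apply: (ae_imply Hu) => x ux /andP[xa xb].
have /ux : `]0, 1[%classic x by rewrite /= in_itv /=; lra.
have xae : `|x - a| < e by rewrite ltr_norml; lra.
have xbe : e <= `|x - b| by rewrite ler_normr; apply/orP; right; lra.
rewrite /u -mulrBl (tent_eq0 e0 xbe) subr0 => /eqP; apply/negP.
rewrite mulf_neq0// gt_eqF ?tent_gt0// subr_gt0.
by apply: D1 => /=; rewrite distrC (lt_le_trans xae).
Qed.

(** The strict inequality is excluded for w and for -w, so w equals its value at 1/2 on the open
    interval; one-sided continuity extends this to 0 and 1. *)
Lemma du_bois_reymond (w : R -> R) : {within `[0, 1], continuous w} ->
  (forall phi, C1c_test phi -> \int[mu]_(x in `]0, 1[) (w x * phi^`()%classic x) = 0) ->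
  forall x, 0 <= x <= 1 -> w x = w 0.
Proof.
move=> cw H.
have cNw : {within `[0, 1], continuous (fun x => - w x)}.
{ move=> x; apply: cvgN; exact: cw. }
have HN phi : C1c_test phi -> \int[mu]_(x in `]0, 1[) (- w x * phi^`()%classic x) = 0.
{ move=> pc; have Hp := H _ pc.
  transitivity (-1 * \int[mu]_(x in `]0, 1[) (w x * phi^`()%classic x)); last by rewrite Hp mulr0.
  rewrite -RintegralZl//.
  { by apply: eq_Rintegral => x _; rewrite mulNr mulN1r. }
  apply: continuous_integrable_itvoo => x; apply: cvgM; first exact: cw.
  by have [_ cdp _ _] := pc; exact: continuous_subspaceT. }
have I a b : 0 < a -> a < b -> b < 1 -> w a = w b.
{ move=> a0 ab b1; have := du_bois_reymond_lt cw H a0 ab b1; have := du_bois_reymond_lt cNw HN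
  a0 ab b1.
  rewrite ltrN2 => /negP; rewrite -leNgt => ?  /negP; rewrite -leNgt => ?.
  by apply/eqP; rewrite eq_le; apply/andP. }
have J x : 0 < x < 1 -> w x = w 2^-1.
{ move=> /andP[x0 x1]; case: (ltrgtP x 2^-1) => [x2|x2|->//]; last apply/esym; apply: I => //;
  lra. }
have [_ c0 c1] := (continuous_within_itvP _ (@ltr01 R)).1 cw.
have w0 : w 0 = w 2^-1.
{ transitivity (lim (w x @[x --> 0^'+])); first by apply/esym; exact: (cvg_lim (@Rhausdorff R)
  c0).
  apply: (cvg_lim (@Rhausdorff R)); apply/cvgrPdist_le => d d0; near=> x.
  rewrite J ?subrr ?normr0 ?ltW//; apply/andP; split; first by near: x; exact: nbhs_right_gt.
  by near: x; apply: nbhs_right_lt; exact: ltr01. }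
have w1 : w 1 = w 2^-1.
{ transitivity (lim (w x @[x --> 1^'-])); first by apply/esym; exact: (cvg_lim (@Rhausdorff R)
  c1).
  apply: (cvg_lim (@Rhausdorff R)); apply/cvgrPdist_le => d d0; near=> x.
  rewrite J ?subrr ?normr0 ?ltW//; apply/andP; split; last by near: x; exact: nbhs_left_lt.
  by near: x; apply: nbhs_left_gt; exact: ltr01. }
move=> x /andP[]; rewrite le_eqVlt => /predU1P[<-//|x0].
by rewrite le_eqVlt => /predU1P[->|x1]; rewrite w0// J// x0.
Unshelve. all: by end_near. Qed.

Lemma integrable_restr (D : set (measurableTypeR R)) (f : R -> R) : measurable D ->
  mu.-integrable D (EFin \o f) -> mu.-integrable setT (EFin \o (f \_ D)).
Proof.
move=> mD fi; rewrite -restrict_EFin.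
exact: (@integrable_mkcond _ (measurableTypeR R) R mu D (EFin \o f) mD).1.
Qed.

Lemma prim_restr f (D : set R) x : (forall y, 0 <= y <= 1 -> D y) -> 0 <= x <= 1 ->
  prim (f \_ D) x = prim f x.
Proof.
move=> H /andP[x0 x1]; apply: eq_Rintegral => y; rewrite inE /= in_itv /= => /andP[y0 yx].
by rewrite patchE mem_set//; apply: H; rewrite y0 (le_trans yx).
Qed.

Lemma C1c_derive_integrable (phi : R -> R) (u : R -> R) : C1c_test phi ->
  {within `[0, 1], continuous u} ->
  mu.-integrable `]0, 1[ (EFin \o (fun x => u x * phi^`()%classic x)).
Proof.
move=> [_ cdp _ _] cu; apply: continuous_integrable_itvoo => x.
apply: cvgM; first exact: cu.
exact: continuous_subspaceT.
Qed.

Lemma C1c_integrable (phi : R -> R) (g : R -> R) : C1c_test phi ->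
  mu.-integrable `]0, 1[ (EFin \o g) ->
  mu.-integrable `]0, 1[ (EFin \o (fun x => g x * phi x)).
Proof.
move=> pc gi; have cp : {within `[0, 1], continuous phi}.
{ by apply: continuous_subspaceT; exact: C1c_continuous. }
have [M _ HM] := within_continuous_bounded (@ler01 R) cp.
apply: (@eq_integrable_EFin _ (measurableTypeR R) R mu _ _ (fun x => phi x * g x)) => //.
{ by move=> x _; rewrite mulrC. }
apply: (@integrableM_bounded _ (measurableTypeR R) R mu _ _ M) => //.
{ by apply: measurable_funTS; apply: continuous_measurable_fun; exact: C1c_continuous. }
by move=> x /=; rewrite in_itv /= => /andP[x0 x1]; apply: HM; rewrite !ltW.
Qed.

(** Integration by parts with phi as the primitive of its own derivative; the boundary term vanishes
    because phi(1) = 0. *)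
Lemma prim_test (phi : R -> R) (g : R -> R) : C1c_test phi -> mu.-integrable setT (EFin \o g) ->
  \int[mu]_(x in `]0, 1[) (prim g x * phi^`()%classic x) =
  - \int[mu]_(x in `]0, 1[) (g x * phi x).
Proof.
move=> pc gi; pose f := phi^`()%classic \_ `[0, 1].
have cdp : {within `[0, 1], continuous phi^`()}.
{ by have [_ cdp _ _] := pc; exact: continuous_subspaceT. }
have fi : mu.-integrable setT (EFin \o f).
{ by apply: integrable_restr => //; exact: continuous_integrable_itv. }
have pf x : 0 <= x <= 1 -> prim f x = phi x.
{ by move=> x01; rewrite prim_restr// ?C1c_prim// => y; rewrite /= in_itv. }
have := prim_by_parts fi gi.
have -> : prim f 1 = 0.
{ rewrite pf ?ler01 ?lexx//; apply: (C1c_out pc); rewrite ltxx andbF //. }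
rewrite mul0r => /eqP; rewrite addr_eq0 => /eqP.
rewrite -!Rintegral_oo_cc => E; etransitivity; last etransitivity; [|exact: E|].
{ apply: eq_Rintegral => x; rewrite inE /= in_itv /= => /andP[x0 x1].
  by rewrite /f patchE mem_setE in_itv /= !ltW// mulrC. }
congr (- _); apply: eq_Rintegral => x; rewrite inE /= in_itv /= => /andP[x0 x1].
by rewrite pf ?ltW// mulrC.
Qed.

Lemma weak_derivative_prim (r g : R -> R) (c : R) : mu.-integrable setT (EFin \o g) ->
  (forall x, 0 <= x <= 1 -> r x = c + prim g x) -> weak_derivative r g.
Proof.
move=> gi rE; split; first exact: integrableT_sub.
move=> phi pc; rewrite -(prim_test pc gi).
have c1 : mu.-integrable `]0, 1[ (EFin \o (fun x => c * phi^`()%classic x)).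
{ by apply: (C1c_derive_integrable pc); apply: continuous_subspaceT => x; exact: cvg_cst. }
have c2 : mu.-integrable `]0, 1[ (EFin \o (fun x => prim g x * phi^`()%classic x)).
{ by apply: (C1c_derive_integrable pc); exact: prim_continuous. }
transitivity (\int[mu]_(x in `]0, 1[) (c * phi^`()%classic x + prim g x * phi^`()%classic x)).
{ apply: eq_Rintegral => x; rewrite inE /= in_itv /= => /andP[x0 x1].
  by rewrite rE ?ltW// mulrDl. }
rewrite RintegralD// RintegralZl//; last first.
{ by apply: (eq_integrable_EFin _ _ (C1c_derive_integrable pc (u := fun=> 1) _)) => [//|x _|];
  rewrite ?mul1r//; apply: continuous_subspaceT => x; exact: cvg_cst. }
have := C1c_prim pc (x := 1); rewrite ler01 lexx => /(_ isT).
rewrite /prim -Rintegral_oo_cc => ->.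
by rewrite (C1c_out pc) ?mulr0 ?add0r// ltxx andbF.
Qed.

Lemma W11_prim (r g : R -> R) (c : R) : mu.-integrable setT (EFin \o g) ->
  (forall x, 0 <= x <= 1 -> r x = c + prim g x) -> W11 r.
Proof.
move=> gi rE.
have cr : {within `[0, 1], continuous r}.
{ apply: (@subspace_eq_continuous _ _ _ (fun x => c + prim g x)).
  { by move=> x; rewrite inE /= in_itv /= => /rE /esym. }
  move=> x; apply: cvgD; first exact: cvg_cst.
  exact: prim_continuous. }
split => //; first exact: continuous_integrable_itvoo.
by exists g; exact: weak_derivative_prim rE.
Qed.

(** Lebesgue differentiation: almost everywhere g is the derivative of its primitive, which is
    constant here. *)
Lemma prim_eq0_ae (g : R -> R) : mu.-integrable setT (EFin \o g) ->
  (forall x, 0 <= x <= 1 -> prim g x = 0) -> {ae mu, forall x, 0 < x < 1 -> g x = 0}.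
Proof.
move=> gi g0.
have lg : locally_integrable setT g.
{ by have := integrable_locally measurableT gi; rewrite patch_setT. }
have H := @FTC1 R g (BLeft 0) (fun y => integrableT_sub (measurable_itv _) gi) lg.
apply: (ae_imply H) => x Hx /andP[x0 x1].
have [] := Hx; first by move: (ltW x0).
move=> _ <-; rewrite derive1E.
rewrite (@near_eq_derive _ _ _ _ (fun=> 0)) ?derive_cst ?oner_neq0//.
near=> y; apply: g0; apply/andP; split; apply: ltW; near: y.
{ exact: lt_nbhsr. }
{ exact: lt_nbhsl. }
Unshelve. all: by end_near. Qed.

(** The difference of r and the primitive has zero weak derivative, hence is constant by
    [du_bois_reymond]. The cut to the open interval is made because a weak derivative is only known
    to be integrable there. *)
Lemma W11_representation (r g : R -> R) : {within `[0, 1], continuous r} ->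
  weak_derivative r g -> forall x, 0 <= x <= 1 -> r x = r 0 + prim (g \_ `]0, 1[) x.
Proof.
move=> cr [gi rg] x x01.
pose g0 := g \_ `]0, 1[.
have g0i : mu.-integrable setT (EFin \o g0) by exact: integrable_restr.
pose w := fun x => r x - prim g0 x.
have cw : {within `[0, 1], continuous w}.
{ move=> y; apply: cvgB; [exact: cr|exact: prim_continuous]. }
suff : w x = w 0 by rewrite /w prim0 subr0 => <-; rewrite subrK.
apply: du_bois_reymond => // phi pc.
transitivity (\int[mu]_(x in `]0, 1[) (r x * phi^`()%classic x - prim g0 x * phi^`()%classic x)).
{ by apply: eq_Rintegral => y _; rewrite mulrBl. }
rewrite RintegralB//; last 2 first.
{ exact: C1c_derive_integrable. }
{ by apply: C1c_derive_integrable => //; exact: prim_continuous. }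
rewrite rg// prim_test// opprK addrC; apply/eqP; rewrite subr_eq0; apply/eqP.
by apply: eq_Rintegral => y yI; rewrite /g0 patchE yI.
Qed.

(** Since [g1] and [g2] give the same integrals against test functions, the primitive of [g1 - g2]
    annihilates their derivatives; it is therefore constant, equal to its value 0 at 0. *)
Lemma weak_derivative_unique (r g1 g2 : R -> R) :
  weak_derivative r g1 -> weak_derivative r g2 -> {ae mu, forall x, 0 < x < 1 -> g1 x = g2 x}.
Proof.
move=> [i1 d1] [i2 d2].
pose g := (fun x => g1 x - g2 x) \_ `]0, 1[.
have gi : mu.-integrable setT (EFin \o g) by apply: integrable_restr => //; exact:
  integrableB_EFin.
have H : {ae mu, forall x, 0 < x < 1 -> g x = 0}.
{ apply: prim_eq0_ae => // x x01; rewrite -[RHS](prim0 g); apply: du_bois_reymond => //.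
  { exact: prim_continuous. }
  move=> phi pc; rewrite prim_test//.
  transitivity (- \int[mu]_(x in `]0, 1[) (g1 x * phi x - g2 x * phi x)).
  { by congr (- _); apply: eq_Rintegral => y yI; rewrite /g patchE yI mulrBl. }
  rewrite RintegralB//; try exact: C1c_integrable.
  by have := d1 _ pc; rewrite d2// => /oppr_inj ->; rewrite subrr oppr0. }
apply: (ae_imply H) => x Hx x01; apply/eqP; rewrite -subr_eq0; apply/eqP.
by rewrite -(Hx x01) /g patchE mem_set//= in_itv.
Qed.

Lemma prim_lt (g : R -> R) x y : mu.-integrable setT (EFin \o g) ->
  (forall x, 0 <= g x) -> (forall x, 0 < x < 1 -> 0 < g x) ->
  0 <= x -> x < y -> y <= 1 -> prim g x < prim g y.
Proof.
move=> gi g0 gp x0 xy y1.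
rewrite -subr_gt0 prim_sub ?x0 ?(ltW xy)// lt_neqAle Rintegral_ge0 ?andbT//.
apply/eqP => /esym I0.
have H := Rintegral0_ae (measurable_itv _) (integrableT_sub (measurable_itv _) gi) (fun x _ =>
  g0 x) I0.
apply: (not_ae_itv xy); apply: (ae_imply H) => z Hz /andP[xz zy].
have := gp z; rewrite Hz ?ltxx /= ?in_itv /= ?(ltW xz) ?(ltW zy)//.
by rewrite (le_lt_trans x0 xz) (lt_le_trans zy y1) => /(_ isT).
Qed.

End weak.

(** * Admissible functions and their energy *)

Section representation.
Context (R : realType).
Notation mu := (@lebesgue_measure R).
Notation D01 := (`]0%R, 1%R[%classic : set (measurableTypeR R)).
Implicit Types (f g r : R -> R) (x : R).

(** [wderiv] picks an unspecified representative. With the slope as a separate argument it can be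
    exchanged for one that is positive on the whole of (0,1). *)
Definition energy_density (n : nat) (kappa : R) (h g r : R -> R) (x : R) : R :=
  x ^+ n.-1 *
  (kappa / n%:R * g x ^+ n + h (g x * (r x / x) ^+ n.-1)
   + kappa * (n%:R - 1) * (g x * (r x / x) ^+ n.-1) * (n%:R^-1 + ln (r x / x))).

Lemma Ihat_ae (n : nat) (kappa : R) (h : R -> R) (lam : R) (r g : R -> R) :
  {ae mu, forall x, 0 < x < 1 -> wderiv r x = g x} ->
  Ihat n kappa h lam r =
  (\int[mu]_(x in `]0%R, 1%R[) (energy_density n kappa h g r x)%:E
   - (kappa * (n%:R - 1) / n%:R * lam ^+ n * ln lam)%:E)%E.
Proof.
move=> rg; rewrite /Ihat; congr (_ - _)%E.
apply: ae_eq_integral_nonmeasurable; apply: (ae_imply rg) => x rgx /=.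
by rewrite in_itv /= => x01; rewrite /energy_density /delta rgx.
Qed.

Lemma wderivP r : W11 r -> weak_derivative r (wderiv r).
Proof. by move=> [_ _ wr]; exact: (@getPex _ [set g | weak_derivative r g]). Qed.

Lemma admissible_representation (lam : R) r : admissible lam r ->
  exists g, [/\ mu.-integrable setT (EFin \o g), forall x, 0 <= g x,
    forall x, 0 < x < 1 -> 0 < g x,
    {ae mu, forall x, 0 < x < 1 -> wderiv r x = g x} &
    forall x, 0 <= x <= 1 -> r x = r 0 + prim g x].
Proof.
move=> [wr _ rp _]; have wd := wderivP wr; have [cr _ _] := wr.
pose d := wderiv r; have [di _] := wd.
(* On the null set where [d] fails to be positive any positive value will do; afterwards h is only
   evaluated on (0,oo), where it is regular. *)
pose g1 x := if 0 < d x then d x else 1.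
pose g := g1 \_ `]0, 1[.
have dg : {ae mu, forall x, 0 < x < 1 -> d x = g x}.
{ apply: (ae_imply rp) => x px x01.
  by rewrite /g patchE mem_set ?/= ?in_itv//= /g1 /d px. }
have md : measurable_fun D01 d by exact: integrable_EFin_measurable di.
have mg1 : measurable_fun D01 g1.
{ apply: measurable_fun_if => //.
  { exact: measurable_fun_ltr. }
  apply: measurable_funS md => //. }
have g1i : mu.-integrable `]0, 1[ (EFin \o g1).
{ apply: (@le_integrable_EFin _ (measurableTypeR R) R mu _ _ _ (fun x => `|d x| + 1)) => //.
  { apply: integrableD_EFin => //; first exact: integrable_norm.
    by apply: continuous_integrable_itvoo; apply: continuous_subspaceT => x; exact: cvg_cst. }
  move=> x _; rewrite /g1; case: ifP => _; first by rewrite lerDl.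
  by rewrite normr1 lerDr. }
have gi : mu.-integrable setT (EFin \o g) by exact: integrable_restr.
exists g; split => //.
{ move=> x; rewrite /g patchE; case: ifP => // _; rewrite /g1; case: ifP => // /ltW //. }
{ move=> x x01; rewrite /g patchE mem_set ?/= ?in_itv//= /g1; case: ifP => //. }
move=> x x01; rewrite (W11_representation cr wd x01); congr (_ + _).
apply: eq_prim => //; apply: (ae_imply dg) => y dy y01.
by rewrite -dy// patchE mem_set// /= in_itv.
Qed.

Lemma admissible_prim (lam c : R) r g : mu.-integrable setT (EFin \o g) ->
  (forall x, 0 < x < 1 -> 0 < g x) ->
  (forall x, 0 <= x <= 1 -> r x = c + prim g x) -> 0 <= c -> r 1 = lam ->
  admissible lam r /\ {ae mu, forall x, 0 < x < 1 -> wderiv r x = g x}.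
Proof.
move=> gi gp rE c0 r1.
have wr := W11_prim gi rE.
have H := weak_derivative_unique (wderivP wr) (weak_derivative_prim gi rE).
split => //; split => //.
{ by apply: (ae_imply H) => x Hx x01; rewrite Hx// gp. }
by rewrite rE ?lexx ?ler01// prim0 addr0.
Qed.

Lemma Rintegral_cst_itv (c : R) x : 0 <= x -> \int[mu]_(t in `[0, x]) c = c * x.
Proof.
move=> x0; rewrite Rintegral_cst//; congr (c * _).
transitivity (fine (mu `[0%R, x]%classic)) => //; rewrite lebesgue_measure_itv /= lte_fin;
  case: ifPn => [_|]; first by rewrite /= subr0.
by rewrite -leNgt => ?; apply/eqP; rewrite eq_le x0; apply/andP.
Qed.

Lemma admissible_linear (lam : R) : 0 < lam ->
  admissible lam (fun x => lam * x) /\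
  {ae mu, forall x, 0 < x < 1 -> wderiv (fun x => lam * x) x = lam}.
Proof.
move=> l0; pose g : R -> R := (fun=> lam) \_ `[0, 1].
have [|||||A W] := @admissible_prim lam 0 (fun x => lam * x) g.
{ apply: integrable_restr => //; apply: continuous_integrable_itv.
  by apply: continuous_subspaceT => x; exact: cvg_cst. }
{ by move=> x /andP[x0 x1]; rewrite /g patchE mem_set//= in_itv /= !ltW. }
{ move=> x x01; rewrite add0r /g prim_restr//; first by rewrite /prim Rintegral_cst_itv//;
  case/andP: x01. }
{ by []. }
{ by rewrite mulr1. }
split => //; apply: (ae_imply W) => x Wx x01; rewrite Wx// /g patchE mem_set//= in_itv /=.
by case/andP: x01 => x0 x1; rewrite !ltW.
Qed.

(** The negative part of the sum f is at most [k], so a finite upper bound on the integral makes f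
    integrable. Then [f1] and [f2] lie between 0 and f + k, and [f3] is what remains. *)
Lemma integrable_of_sum (D : set (measurableTypeR R)) (f1 f2 f3 k : R -> R) : measurable D ->
  measurable_fun D f1 -> measurable_fun D f2 -> measurable_fun D f3 ->
  mu.-integrable D (EFin \o k) ->
  (forall x, D x -> 0 <= f1 x) -> (forall x, D x -> 0 <= f2 x) ->
  (forall x, D x -> 0 <= k x) ->
  (forall x, D x -> - k x <= f3 x) ->
  (\int[mu]_(x in D) (f1 x + f2 x + f3 x)%:E < +oo)%E ->
  [/\ mu.-integrable D (EFin \o f1), mu.-integrable D (EFin \o f2) &
      mu.-integrable D (EFin \o f3)].
Proof.
move=> mD m1 m2 m3 ki p1 p2 pk l3 foo.
pose f x := f1 x + f2 x + f3 x.
have mf : measurable_fun D f by do 2 apply: measurable_funD => //.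
have mfE : measurable_fun D (EFin \o f) by exact/measurable_EFinP.
have mk : measurable_fun D k by exact: integrable_EFin_measurable ki.
have fk x : D x -> 0 <= f x + k x.
{ by move=> Dx; have := p1 x Dx; have := p2 x Dx; have := l3 x Dx; rewrite /f; lra. }
have nin : (\int[mu]_(x in D) ((EFin \o f)^\- x) < +oo)%E.
{ apply: le_lt_trans (integrable_lty mD ki); apply: ge0_le_integral => //.
  { exact: measurable_funeneg. }
  { exact: measurable_int ki. }
  move=> x Dx; rewrite funenegE /= ge_max !lee_fin pk// andbT.
  by have := fk x Dx; lra. }
have pin : (\int[mu]_(x in D) ((EFin \o f)^\+ x) < +oo)%E.
{ have aux (s t : \bar R) : (s - t < +oo -> 0 <= t -> t < +oo -> s < +oo)%E.
  { by case: s t => [s||] [t||]; rewrite ?ltry ?ltxx //=. }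
  move: foo; rewrite -[X in (X < _)%E]/(\int[mu]_(x in D) ((EFin \o f) x))%E integralE.
  move=> /aux; apply => //; apply: integral_ge0 => x _; exact: funeneg_ge0. }
have fi : mu.-integrable D (EFin \o f).
{ apply/integrableP; split => //.
  have -> : (\int[mu]_(x in D) `|(EFin \o f) x| =
    \int[mu]_(x in D) ((EFin \o f)^\+ x + (EFin \o f)^\- x))%E.
  { by apply: eq_integral => x _; rewrite -[LHS]/((abse \o (EFin \o f)) x) fune_abse. }
  rewrite ge0_integralD//; [exact: lte_add_pinfty|exact: measurable_funepos|exact:
    measurable_funeneg]. }
have i1 : mu.-integrable D (EFin \o f1).
{ apply: (@le_integrable_EFin _ (measurableTypeR R) R mu _ _ _ (fun x => f x + k x)) => //;
  first exact: integrableD_EFin.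
  move=> x Dx; rewrite ger0_norm ?p1//.
  by have := p1 x Dx; have := p2 x Dx; have := l3 x Dx; rewrite /f; lra. }
have i2 : mu.-integrable D (EFin \o f2).
{ apply: (@le_integrable_EFin _ (measurableTypeR R) R mu _ _ _ (fun x => f x + k x)) => //;
  first exact: integrableD_EFin.
  move=> x Dx; rewrite ger0_norm ?p2//.
  by have := p1 x Dx; have := p2 x Dx; have := l3 x Dx; rewrite /f; lra. }
split => //.
apply: (@eq_integrable_EFin _ (measurableTypeR R) R mu _ _ (fun x => f x - (f1 x + f2 x))) => //.
{ by move=> x _; rewrite /f addrC addKr. }
by apply: integrableB_EFin => //; exact: integrableD_EFin.
Qed.

End representation.

(** * The first variation *)

Section variation.
Context (R : realType).
Notation mu := (@lebesgue_measure R).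

Lemma MVT_le (f df : R -> R) (t M : R) : 0 <= t ->
  (forall s, 0 <= s <= t -> is_derive s (1 : R) f (df s)) ->
  (forall s, 0 <= s <= t -> `|df s| <= M) -> `|f t - f 0| <= M * t.
Proof.
move=> t0 fd fM.
have [||s sI ->] := @MVT_segment R f df 0 t t0.
{ by move=> s; rewrite in_itv /= => /andP[s0 st]; apply: fd; rewrite !ltW. }
{ apply: derivable_within_continuous => s; rewrite in_itv /= => sI.
  by have [] := fd s sI. }
by rewrite subr0 normrM (ger0_norm t0) ler_wpM2r// fM//.
Qed.

(** Along a sequence of positive t the difference quotients have nonnegative integral by minimality,
    are dominated by [G] through the mean value theorem, and converge pointwise to [e' 0]; dominated
    convergence concludes. *)
Lemma first_variation_ge0 (D : set (measurableTypeR R)) (e e' : R -> R -> R) (G : R -> R) (eps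
  : R) :
  measurable D -> 0 < eps ->
  (forall t, 0 <= t <= eps -> measurable_fun D (e t)) ->
  mu.-integrable D (EFin \o G) ->
  (forall x t, D x -> 0 <= t <= eps -> is_derive t (1 : R) (e ^~ x) (e' t x)) ->
  (forall x t, D x -> 0 <= t <= eps -> `|e' t x| <= G x) ->
  mu.-integrable D (EFin \o e 0) ->
  (forall t, 0 <= t <= eps ->
    (\int[mu]_(x in D) (e 0 x)%:E <= \int[mu]_(x in D) (e t x)%:E)%E) ->
  mu.-integrable D (EFin \o e' 0) /\ 0 <= \int[mu]_(x in D) e' 0 x.
Proof.
move=> mD eps0 me Gi ed eG e0i emin.
(* [harmonic k] is 1 / (k + 1), so every t(k) lies in (0, eps]. *)
pose t (k : nat) : R := eps * harmonic k.
have tI k : 0 < t k <= eps.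
{ rewrite /t /harmonic /= mulr_gt0//= ger_pMr// invf_le1// ler1n //. }
have t0 k : 0 < t k by have /andP[] := tI k.
have tI' k : 0 <= t k <= eps by have /andP[/ltW -> ->] := tI k.
have i0 : 0 <= (0 : R) <= eps by rewrite lexx ltW.
have tcvg : t @ \oo --> (0 : R).
{ rewrite -[X in _ --> X](mulr0 eps); apply: cvgM; [exact: cvg_cst|exact: cvg_harmonic]. }
pose u k x := (e (t k) x - e 0 x) / t k.
have mu_ k : measurable_fun D (u k).
{ apply: measurable_funM => //; apply: measurable_funB; exact: me. }
have uG k x : D x -> `|u k x| <= G x.
{ move=> Dx; rewrite normrM normfV (gtr0_norm (t0 k)) ler_pdivrMr//.
  apply: (@MVT_le (e ^~ x) (e' ^~ x)) => //; first exact: ltW.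
  { by move=> s /andP[s0 st]; apply: ed => //; rewrite s0 (le_trans st)//; have /andP[] := tI k. }
  by move=> s /andP[s0 st]; apply: eG => //; rewrite s0 (le_trans st)//; have /andP[] := tI k. }
have ucvg x : D x -> u ^~ x @ \oo --> e' 0 x.
{ move=> Dx; have /is_derive1_caratheodory[q [qE qc <-]] := ed x 0 Dx i0.
  rewrite (_ : u ^~ x = (fun k => q (t k))).
  { apply: (cvg_comp _ _ tcvg); exact: qc. }
  apply/funext => k; rewrite /u; have := qE (t k); rewrite subr0 => ->.
  by rewrite mulfK// gt_eqF. }
have me' : measurable_fun D (e' 0).
{ first [exact: (measurable_fun_cvg mu_ ucvg) | exact: (measurable_fun_cvg mD mu_ ucvg)]. }
have ui k : mu.-integrable D (EFin \o u k).
{ by apply: (@le_integrable_EFin _ (measurableTypeR R) R mu _ _ _ G) => //; exact: uG. }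
have [] := @dominated_convergence _ (measurableTypeR R) R mu D mD (fun k => EFin \o u k) (EFin
  \o e' 0) (EFin \o G).
{ by move=> k; apply/measurable_EFinP. }
{ by apply/measurable_EFinP. }
{ by apply: aeW => x Dx; apply: cvg_EFin; [apply: nearW|exact: ucvg]. }
{ exact: Gi. }
{ by apply: aeW => x k Dx /=; rewrite lee_fin uG. }
move=> e'i _ cv; split => //.
rewrite -lee_fin /Rintegral fineK; last exact: integrable_fin_num.
apply: (cvge_ge _ cv) => //; apply: nearW => k /=.
have ei : mu.-integrable D (EFin \o e (t k)).
{ apply: (@eq_integrable_EFin _ (measurableTypeR R) R mu _ _ (fun x => e 0 x + u k x * t k)) =>
  //.
  { by move=> x _; rewrite /u divfK ?gt_eqF// subrKC. }
  by apply: integrableD_EFin => //; exact: integrableZr_EFin. }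
rewrite (_ : (\int[mu]_(x in D) (u k x)%:E)%E = (\int[mu]_(x in D) u k x)%:E); last first.
{ by rewrite /Rintegral fineK//; exact: (integrable_fin_num mD (ui k)). }
rewrite lee_fin /u RintegralZr//; last exact: integrableB_EFin.
rewrite RintegralB// mulr_ge0 ?invr_ge0 ?(ltW (t0 k))// subr_ge0.
have := emin _ (tI' k); rewrite /Rintegral => H; apply: fine_le => //; exact: integrable_fin_num.
Qed.

Lemma ln_ge1BV (y : R) : 0 < y -> 1 - y^-1 <= ln y.
Proof.
move=> y0; have := @le_ln1Dx R (y^-1 - 1).
rewrite subrKC lnV ?posrE// ltrBrDl subrr invr_gt0 => /(_ y0); lra.
Qed.

Lemma ln_leB1 (y : R) : 0 < y -> ln y <= y - 1.
Proof.
move=> y0; have := @le_ln1Dx R (y - 1).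
rewrite subrKC ltrBrDl subrr => /(_ y0); lra.
Qed.

(** * The varied integrand at a fixed point *)

Section pointwise.
Variables (m : nat) (kappa : R) (h : R -> R).
Hypothesis kappa_gt0 : 0 < kappa.
Hypothesis h_ge0 : forall d : R, 0 < d -> 0 <= h d.
Hypothesis h_derivable : forall d : R, 0 < d -> derivable h d 1.
Variables (K gamma0 : R).
Hypotheses (K0 : 0 < K) (gamma00 : 0 < gamma0).
Hypothesis h_growth : forall d c : R, 0 < d -> 0 < c -> `|c - 1| <= gamma0 ->
       `|d * h^`()%classic (c * d)| <= K * (h d + 1).

(* Under the variation r' -> r' (1 + t w), r -> r (1 + t rho) the determinant delta
   is multiplied by [stretch w rho t], which is close to 1: this is what makes the
   growth hypothesis applicable. *)
Definition stretch (w rho t : R) : R := (1 + t * w) * (1 + t * rho) ^+ m.+1.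
Definition dstretch (w rho t : R) : R :=
  w * (1 + t * rho) ^+ m.+1 + (1 + t * w) * (m.+1%:R * rho * (1 + t * rho) ^+ m).
(** The integrand of the varied map as a function of t alone: [E1] and [E3] are the gradient and
    logarithmic terms at t = 0, q is x^(n-1), d is delta, and rho = phi / r. The last summand comes
    from splitting ln((r/x)(1 + t rho)). *)
Definition perturbed (E1 E3 q d w rho t : R) : R :=
  E1 * (1 + t * w) ^+ m.+2 + q * h (d * stretch w rho t) + E3 * stretch w rho t
  + kappa * m.+1%:R * q * d * (stretch w rho t * ln (1 + t * rho)).
Definition dperturbed (E1 E3 q d w rho t : R) : R :=
  E1 * (m.+2%:R * w * (1 + t * w) ^+ m.+1)
  + q * (h^`()%classic (d * stretch w rho t) * (d * dstretch w rho t))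
  + E3 * dstretch w rho t
  + kappa * m.+1%:R * q * d *
    (dstretch w rho t * ln (1 + t * rho) + stretch w rho t * (rho / (1 + t * rho))).

Lemma is_derive_affine (w t : R) : is_derive t (1 : R) (fun s => 1 + s * w) w.
Proof.
have := is_deriveD (is_derive_cst (1 : R) t (1:R)) (is_deriveM (is_derive_id t (1:R))
  (is_derive_cst w t (1:R))).
rewrite add0r scaler0 add0r => H; apply: is_derive_eq H _.
by rewrite /GRing.scale /= mulr1.
Qed.

Lemma is_derive_affineX (w t : R) k :
  is_derive t (1 : R) (fun s => (1 + s * w) ^+ k.+1) (k.+1%:R * w * (1 + t * w) ^+ k).
Proof.
have H := is_deriveX k.+1 (is_derive_affine w t).
rewrite (_ : (fun s => _) = (fun s => 1 + s * w) ^+ k.+1); last by rewrite exprfctE.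
by apply: is_derive_eq H _; rewrite /GRing.scale /= mulrAC.
Qed.

Lemma is_derive_stretch w rho t :
  is_derive t (1 : R) (stretch w rho) (dstretch w rho t).
Proof.
have H := is_deriveM (is_derive_affine w t) (is_derive_affineX rho t m).
apply: is_derive_eq H _; rewrite /GRing.scale /= /dstretch; ring.
Qed.

Lemma is_derive_perturbed (E1 E3 q d w rho t : R) : 0 < d -> 0 < 1 + t * w -> 0 < 1 + t * rho ->
  is_derive t (1 : R) (perturbed E1 E3 q d w rho) (dperturbed E1 E3 q d w rho t).
Proof.
move=> d0 tw tr.
have s0 : 0 < stretch w rho t by rewrite mulr_gt0// exprn_gt0.
have H1 := is_deriveZ E1 (is_derive_affineX w t m.+1).
have hs : is_derive (d * stretch w rho t) (1 : R) h (h^`()%classic (d * stretch w rho t)).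
{ split; first by apply: h_derivable; rewrite mulr_gt0.
  by rewrite derive1E. }
have Hs := is_derive_stretch w rho t.
have Hd : is_derive t (1 : R) (fun s => d * stretch w rho s) (d * dstretch w rho t) by exact:
  is_deriveZ.
have H2 := is_deriveZ q (@is_derive1_comp R h (fun s => d * stretch w rho s) t _ _ hs Hd).
have H3 := is_deriveZ E3 Hs.
have Hl := @is_derive1_comp R (@ln R) (fun s => 1 + s * rho) t _ _ (is_derive1_ln tr)
  (is_derive_affine rho t).
have H4 := is_deriveZ (kappa * m.+1%:R * q * d) (is_deriveM Hs Hl).
apply: is_derive_eq (is_deriveD (is_deriveD (is_deriveD H1 H2) H3) H4) _.
rewrite /GRing.scale /= /dperturbed.
by congr (_ + _ * _); rewrite addrC [ln _ * _]mulrC [_^-1 * rho]mulrC.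
Qed.

Lemma dperturbed0 E1 E3 q d w rho : dperturbed E1 E3 q d w rho 0 =
  E1 * (m.+2%:R * w) + q * (h^`()%classic d * (d * (w + m.+1%:R * rho)))
  + E3 * (w + m.+1%:R * rho) + kappa * m.+1%:R * q * d * rho.
Proof.
by rewrite /dperturbed /stretch /dstretch !(mul0r, addr0, expr1n, ln1, mulr1, mul1r, mulr0,
  divr1, add0r).
Qed.

Lemma perturbed0 E1 E3 q d w rho : perturbed E1 E3 q d w rho 0 = E1 + q * h d + E3.
Proof.
by rewrite /perturbed /stretch !mul0r !addr0 !expr1n ln1 !mulr1 !mulr0 addr0.
Qed.

(** For small t the growth condition applies with c = [stretch w rho t] and bounds the h' term by a
    multiple of h(d) + 1; all other factors are bounded. The constants do not depend on the point
    x. *)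
Lemma dperturbed_bound (B : R) : 1 <= B ->
  exists eps C, [/\ 0 < eps, 0 <= C, eps * B <= 2^-1 &
    forall E1 E3 q d w rho t, 0 <= E1 -> 0 <= q -> 0 < d -> `|w| <= B -> `|rho| <= B ->
      0 <= t <= eps ->
      `|dperturbed E1 E3 q d w rho t| <= C * (E1 + q * (h d + 1) + `|E3| + q * d)].
Proof.
move=> B1; have B0 : 0 < B by lra.
(* A bound for [dstretch] as long as 1 + t w and 1 + t rho stay at most 2. *)
pose C1 : R := B * 2 ^+ m.+1 + 2 * (m.+1%:R * B * 2 ^+ m).
have C10 : 0 < C1 by rewrite /C1 addr_gt0// !mulr_gt0// exprn_gt0.
(* The first entry keeps 1 + t w and 1 + t rho above 1/2 and below 2; the second, by the mean value
   theorem, keeps [stretch] within [gamma0] of 1. *)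
pose eps := Num.min (2^-1 / B) (gamma0 / C1).
have e0 : 0 < eps by rewrite lt_min !divr_gt0.
have eB : eps * B <= 2^-1 by rewrite -ler_pdivlMr// ge_min lexx.
have eC : eps * C1 <= gamma0 by rewrite -ler_pdivlMr// ge_min lexx orbT.
pose C2 : R := m.+2%:R * B * 2 ^+ m.+1.
pose C3 : R := kappa * m.+1%:R * (C1 + 2 ^+ m.+2 * (2 * B)).
have C20 : 0 <= C2 by rewrite !mulr_ge0// ?exprn_ge0// ltW.
have C30 : 0 <= C3.
{ rewrite !mulr_ge0//; first exact: ltW.
  apply: addr_ge0; first exact: ltW.
  by apply: mulr_ge0; [exact: exprn_ge0|rewrite mulr_ge0// ltW]. }
exists eps, (C2 + K * C1 + C1 + C3); split => //.
{ by rewrite !addr_ge0// ?mulr_ge0// ltW. }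
move=> E1 E3 q d w rho t E10 q0 d0 wB rB tI.
have near1 v s : `|v| <= B -> 0 <= s <= eps -> 2^-1 <= 1 + s * v <= 2.
{ move=> vB /andP[s0 se]; have : `|s * v| <= 2^-1.
  { rewrite normrM (ger0_norm s0); apply: le_trans eB; apply: ler_pM => //. }
  rewrite ler_norml; lra. }
have powle v s k : `|v| <= B -> 0 <= s <= eps -> 0 <= (1 + s * v) ^+ k <= 2 ^+ k.
{ move=> vB sI; have /andP[v1 v2] := near1 v s vB sI.
  by rewrite exprn_ge0 ?lerXn2r ?nnegrE//; lra. }
have dsb s : 0 <= s <= eps -> `|dstretch w rho s| <= C1.
{ move=> sI; apply: (le_trans (ler_normD _ _)); apply: lerD.
  { by rewrite normrM; apply: ler_pM => //; have /andP[? ?] := powle rho s m.+1 rB sI; rewrite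
    ger0_norm. }
  have /andP[p1 p2] := powle rho s m rB sI; have /andP[w1 w2] := near1 w s wB sI.
  rewrite normrM; apply: ler_pM => //; first by rewrite ger0_norm//; lra.
  rewrite !normrM (ger0_norm p1) ger0_norm//; apply: ler_pM => //.
  by rewrite ler_wpM2l. }
have /andP[t0 te] := tI.
have /andP[w1 w2] := near1 w t wB tI; have /andP[r1 r2] := near1 rho t rB tI.
have st : `|stretch w rho t - 1| <= gamma0.
{ have := @MVT_le (stretch w rho) (dstretch w rho) t C1 t0 (fun s _ => is_derive_stretch w rho s).
  rewrite {2}/stretch !mul0r addr0 expr1n mulr1 => H.
  apply: (le_trans (H _)); last by rewrite mulrC (le_trans _ eC)// ler_wpM2r// ltW.
  by move=> s /andP[s0 se]; apply: dsb; rewrite s0 (le_trans se). }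
have s0 : 0 < stretch w rho t by rewrite mulr_gt0// ?exprn_gt0//; lra.
have s2 : stretch w rho t <= 2 ^+ m.+2.
{ rewrite exprS; apply: ler_pM => //; have /andP[? ?] := powle rho t m.+1 rB tI => //; lra. }
have ds := dsb t tI.
have hd : 0 <= h d by exact: h_ge0.
have hb : `|h^`()%classic (d * stretch w rho t) * (d * dstretch w rho t)| <= K * C1 * (h d + 1).
{ rewrite mulrCA mulrA normrM (mulrAC K) ; apply: ler_pM => //.
  by rewrite [X in h^`()%classic X]mulrC; exact: h_growth. }
have lnb : `|ln (1 + t * rho)| <= 1.
{ have l1 := @ln_ge1BV (1 + t * rho); have l2 := @ln_leB1 (1 + t * rho).
  have : (1 + t * rho)^-1 <= 2 by rewrite -[leRHS]invrK lef_pV2 ?posrE//; lra.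
  by move=> ?; rewrite ler_norml; apply/andP; split; [have := l1 _|have := l2 _]; lra. }
have rb : `|rho / (1 + t * rho)| <= 2 * B.
{ rewrite normrM normfV mulrC; apply: ler_pM => //; rewrite gtr0_norm; last lra.
  by rewrite -[leRHS]invrK lef_pV2 ?posrE//; lra. }
have b1 : `|E1 * (m.+2%:R * w * (1 + t * w) ^+ m.+1)| <= C2 * E1.
{ rewrite normrM (ger0_norm E10) mulrC ler_wpM2r// !normrM ger0_norm//.
  have /andP[? ?] := powle w t m.+1 wB tI; rewrite (ger0_norm (x := _ ^+ _))//.
  by apply: ler_pM => //; rewrite ?mulr_ge0// ler_wpM2l. }
have b2 : `|q * (h^`()%classic (d * stretch w rho t) * (d * dstretch w rho t))| <= K * C1 * (q
  * (h d + 1)).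
{ by rewrite normrM (ger0_norm q0) [leRHS]mulrCA ler_wpM2l. }
have b3 : `|E3 * dstretch w rho t| <= C1 * `|E3|.
{ by rewrite normrM mulrC ler_wpM2r. }
have b4 : `|kappa * m.+1%:R * q * d *
    (dstretch w rho t * ln (1 + t * rho) + stretch w rho t * (rho / (1 + t * rho)))| <= C3 * (q
      * d).
{ have km : 0 <= kappa * m.+1%:R by rewrite mulr_ge0// ltW.
  have -> : C3 * (q * d) = kappa * m.+1%:R * q * d * (C1 + 2 ^+ m.+2 * (2 * B)) by rewrite /C3;
    ring.
  have kq : 0 <= kappa * m.+1%:R * q * d by rewrite !(mulr_ge0 km, mulr_ge0)// ltW.
  rewrite normrM (ger0_norm kq) ler_wpM2l//.
  apply: (le_trans (ler_normD _ _)); apply: lerD.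
  { by rewrite normrM -[leRHS]mulr1; apply: ler_pM. }
  by rewrite normrM; apply: ler_pM => //; rewrite gtr0_norm. }
rewrite /dperturbed.
set a1 := E1 * _ in b1 *; set a2 := q * _ in b2 *; set a3 := E3 * _ in b3 *; set a4 := kappa *
  _ * _ * _ * _ in b4 *.
have tri : `|a1 + a2 + a3 + a4| <= `|a1| + `|a2| + `|a3| + `|a4|.
{ apply: (le_trans (ler_normD _ _)); rewrite lerD2r.
  by apply: (le_trans (ler_normD _ _)); rewrite lerD2r; exact: ler_normD. }
have qh : 0 <= q * (h d + 1) by rewrite mulr_ge0// addr_ge0.
have qd : 0 <= q * d by rewrite mulr_ge0// ltW.
have KC : 0 <= K * C1 by rewrite mulr_ge0// ltW.
have C1' := ltW C10; have e3 := normr_ge0 E3.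
(* The claimed bound is a product of two sums of four terms. Its diagonal part is given by [b1] to
   [b4]; the twelve cross terms are nonnegative. *)
have := mulr_ge0 C20 qh; have := mulr_ge0 C20 e3; have := mulr_ge0 C20 qd.
have := mulr_ge0 KC E10; have := mulr_ge0 KC e3; have := mulr_ge0 KC qd.
have := mulr_ge0 C1' E10; have := mulr_ge0 C1' qh; have := mulr_ge0 C1' qd.
have := mulr_ge0 C30 E10; have := mulr_ge0 C30 qh; have := mulr_ge0 C30 e3.
move: tri b1 b2 b3 b4; move: (K * C1) => KC1.
move: (q * (h d + 1)) (q * d) `|E3| `|a1| `|a2| `|a3| `|a4| => Q1 Q2 Q3 n1 n2 n3 n4.
clear; move: C1 C2 C3 => C1 C2 C3; rewrite !(mulrDl, mulrDr); lra.
Qed.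

End pointwise.
End variation.

(** * The integrated Euler-Lagrange equation *)

Section weak_Euler_Lagrange.
Context (R : realType).
Notation mu := (@lebesgue_measure R).
Notation D01 := (`]0%R, 1%R[%classic : set (measurableTypeR R)).
Variables (m : nat) (kappa : R) (h : R -> R).
Hypothesis kappa_gt0 : 0 < kappa.
Hypothesis h_ge0 : forall d : R, 0 < d -> 0 <= h d.
Hypothesis h_derivable : forall d : R, 0 < d -> derivable h d 1.
Hypothesis h'_continuous : forall d : R, 0 < d -> {for d, continuous h^`()}.

Lemma measurable_comp_pos (f : R -> R) (d : R -> R) :
  (forall y : R, 0 < y -> {for y, continuous f}) ->
  measurable_fun D01 d -> (forall x, 0 < x < 1 -> 0 < d x) ->
  measurable_fun D01 (fun x => f (d x)).
Proof.
move=> fc md dp.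
have mf : measurable_fun (`]0%R, +oo[%classic : set (measurableTypeR R)) f.
{ apply: open_continuous_measurable_fun; first exact: interval_open.
  by move=> y; rewrite inE /= in_itv /= andbT => /fc. }
apply: (@measurable_comp _ _ _ (measurableTypeR R) (measurableTypeR R) (measurableTypeR R)
  `]0%R, +oo[%classic) => //.
by move=> _ [x /= x01 <-]; rewrite in_itv /= andbT dp//; move: x01; rewrite in_itv.
Qed.

Lemma h_continuous (d : R) : 0 < d -> {for d, continuous h}.
Proof. by move=> d0; apply/differentiable_continuous/derivable1_diffP/h_derivable. Qed.

Lemma measurable_ratio (S : R -> R) : {within `[0, 1], continuous S} ->
  measurable_fun D01 (fun x => S x / x).
Proof.
move=> cS; apply: open_continuous_measurable_fun; first exact: interval_open.
move=> x; rewrite inE /= in_itv /= => x01.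
have [x0 x1] := andP x01.
apply: cvgM; first exact: (within_interior_continuous cS x01).
by apply: cvgV; [rewrite gt_eqF|exact: cvg_id].
Qed.

Lemma measurable_det_ofW (G S : R -> R) : measurable_fun D01 G -> {within `[0, 1], continuous
  S} ->
  measurable_fun D01 (fun x => G x * (S x / x) ^+ m.+1).
Proof.
by move=> mG cS; apply: measurable_funM => //; apply: measurable_funX; exact: measurable_ratio.
Qed.

Lemma measurable_Xn k : measurable_fun D01 (fun x : R => x ^+ k).
Proof. by apply: measurable_funX. Qed.

(** * The three terms of the integrand *)

Section terms.
Variables (r g : R -> R).
(* With [g] in the role of r', [det_of] is delta, and the integrand of [Ihat] for
   [n = m.+2] is the sum of the three terms. *)
Definition det_of x := g x * (r x / x) ^+ m.+1.
Definition grad_term x := x ^+ m.+1 * (kappa / m.+2%:R * g x ^+ m.+2).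
Definition bulk_term x := x ^+ m.+1 * h (det_of x).
Definition log_term x := kappa * m.+1%:R * x ^+ m.+1 * det_of x * (m.+2%:R^-1 + ln (r x / x)).

Lemma energy_densityE x : energy_density m.+2 kappa h g r x = grad_term x + bulk_term x +
  log_term x.
Proof.
rewrite /energy_density /grad_term /bulk_term /log_term -/(det_of x).
have -> : m.+2%:R - 1 = m.+1%:R :> R by rewrite mulrSr addrK.
rewrite /=; ring.
Qed.

Hypotheses (mg : measurable_fun D01 g) (cr : {within `[0, 1], continuous r}).
Hypotheses (gp : forall x, 0 < x < 1 -> 0 < g x) (rp : forall x, 0 < x < 1 -> 0 < r x).

Lemma det_of_gt0 x : 0 < x < 1 -> 0 < det_of x.
Proof.
move=> x01; rewrite mulr_gt0// ?gp// exprn_gt0// divr_gt0// ?rp//; by case/andP: x01.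
Qed.

(** The weight absorbs the powers of 1/x in delta; near the origin it then suffices that r is
    bounded and g integrable. *)
Lemma Xn_det_ofE x : 0 < x -> x ^+ m.+1 * det_of x = r x ^+ m.+1 * g x.
Proof.
by move=> x0; rewrite /det_of expr_div_n mulrC -mulrA divfK ?expf_neq0 ?gt_eqF// mulrC.
Qed.

Lemma measurable_det_of : measurable_fun D01 det_of. Proof. exact: measurable_det_ofW. Qed.

Lemma measurable_grad_term : measurable_fun D01 grad_term.
Proof.
by apply: measurable_funM; [exact: measurable_Xn|apply: measurable_funM => //; exact:
  measurable_funX].
Qed.

Lemma measurable_bulk_term : measurable_fun D01 bulk_term.
Proof.
apply: measurable_funM; first exact: measurable_Xn.
by apply: measurable_comp_pos => //; [exact: h_continuous|exact: measurable_det_of|exact: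
  det_of_gt0].
Qed.

Lemma measurable_log_term : measurable_fun D01 log_term.
Proof.
apply: measurable_funM.
{ apply: measurable_funM; last exact: measurable_det_of.
  by apply: measurable_funM => //; exact: measurable_Xn. }
apply: measurable_funD => //.
apply: (measurableT_comp (@measurable_ln R)); exact: measurable_ratio.
Qed.

Lemma measurable_density : measurable_fun D01 (energy_density m.+2 kappa h g r).
Proof.
apply: (@eq_measurable_fun _ _ (measurableTypeR R) (measurableTypeR R) _ (fun x => grad_term x
  + bulk_term x + log_term x)).
{ by move=> x _; rewrite energy_densityE. }
apply: measurable_funD; last exact: measurable_log_term.
by apply: measurable_funD; [exact: measurable_grad_term|exact: measurable_bulk_term].
Qed.

Lemma grad_term_ge0 x : 0 < x < 1 -> 0 <= grad_term x.
Proof.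
move=> x01; have g0 := gp x01; case/andP: x01 => x0 x1.
by apply: mulr_ge0; [exact/exprn_ge0/ltW|apply: mulr_ge0; [apply: divr_ge0 => //; exact:
  ltW|exact/exprn_ge0/ltW]].
Qed.

Lemma bulk_term_ge0 x : 0 < x < 1 -> 0 <= bulk_term x.
Proof.
move=> x01; apply: mulr_ge0; last exact/h_ge0/det_of_gt0.
by apply: exprn_ge0; case/andP: x01 => /ltW.
Qed.

(* [r ln r] is bounded below, so the logarithm costs at most a multiple of r'. *)
Lemma log_term_ge lam x : 0 < x < 1 -> r x <= lam -> - (kappa * m.+1%:R * lam ^+ m * g x) <=
  log_term x.
Proof.
move=> x01 rl; have g0 := gp x01; have r0 := rp x01; case/andP: x01 => x0 x1.
rewrite /log_term -2!(mulrA (kappa * m.+1%:R)) Xn_det_ofE//.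
have k0 : 0 < kappa * m.+1%:R by rewrite mulr_gt0.
rewrite -mulrN.
rewrite -[leRHS]mulrA ler_wpM2l ?(ltW k0)//.
have -> : r x ^+ m.+1 * g x * (m.+2%:R^-1 + ln (r x / x)) =
   (r x ^+ m.+1 * (m.+2%:R^-1 + ln (r x / x))) * g x by ring.
rewrite -mulNr ler_wpM2r ?(ltW g0)//.
(* From ln(r/x) >= 1 - x/r, the factor in front of g is at least -r^m x, hence at least -lam^m. *)
have H := ln_ge1BV (divr_gt0 r0 x0); rewrite invf_div in H.
have n0 : 0 <= (m.+2%:R^-1 : R) by rewrite invr_ge0.
have pw : 0 < r x ^+ m.+1 by rewrite exprn_gt0.
apply: (@le_trans _ _ (r x ^+ m.+1 * (- (x / r x)))); last by rewrite ler_wpM2l ?(ltW pw)//;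
  move: (ln _) (x / r x) (m.+2%:R^-1) H n0 => *; lra.
rewrite mulrN lerN2 exprSr mulrACA -mulrA mulrCA mulfV ?gt_eqF// mulr1.
apply: (@le_trans _ _ (r x ^+ m)).
{ by rewrite ger_pMl ?exprn_gt0// ltW. }
by apply: lerXn2r => //; rewrite nnegrE ltW// (lt_le_trans r0).
Qed.

End terms.

(** * Integrability and variations at a minimizer *)

Section minimizer.
Variables (lam : R) (r g : R -> R).
Hypothesis lam_gt0 : 0 < lam.
Hypothesis gi : mu.-integrable setT (EFin \o g).
Hypothesis g_ge0 : forall x, 0 <= g x.
Hypothesis g_gt0 : forall x, 0 < x < 1 -> 0 < g x.
Hypothesis rE : forall x, 0 <= x <= 1 -> r x = r 0 + prim g x.
Hypothesis r0 : 0 <= r 0.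
Hypothesis r1 : r 1 = lam.
Hypothesis wg : {ae mu, forall x, 0 < x < 1 -> wderiv r x = g x}.
Hypothesis r_min : forall s, admissible lam s ->
  (Ihat m.+2 kappa h lam r <= Ihat m.+2 kappa h lam s)%E.

Lemma radial_continuous : {within `[0, 1], continuous r}.
Proof. by have [] := W11_prim gi rE. Qed.

Lemma radial_lt x y : 0 <= x -> x < y -> y <= 1 -> r x < r y.
Proof.
move=> x0 xy y1; have x1 := le_trans (ltW xy) y1; have y0 := le_trans x0 (ltW xy).
rewrite (rE (introT andP (conj x0 x1))) (rE (introT andP (conj y0 y1))) ltrD2l.
exact: prim_lt.
Qed.

Lemma radial_le x y : 0 <= x -> x <= y -> y <= 1 -> r x <= r y.
Proof.
by move=> x0; rewrite le_eqVlt => /predU1P[->//|xy] y1; rewrite ltW// radial_lt.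
Qed.

Lemma radial_gt0 x : 0 < x <= 1 -> 0 < r x.
Proof. by move=> /andP[x0 x1]; rewrite (le_lt_trans r0)// radial_lt. Qed.

Lemma radial_gt0_oo x : 0 < x < 1 -> 0 < r x.
Proof. by move=> /andP[x0 x1]; rewrite radial_gt0// x0 ltW. Qed.

Lemma radial_le_lam x : 0 <= x <= 1 -> r x <= lam.
Proof. by move=> /andP[x0 x1]; rewrite -r1 radial_le. Qed.

Lemma g_measurable : measurable_fun D01 g.
Proof. by apply: measurable_funTS; exact: integrable_EFin_measurable gi. Qed.

Lemma Ihat_finite : (\int[mu]_(x in `]0%R, 1%R[) (energy_density m.+2 kappa h g r x)%:E < +oo)%E.
Proof.
have [A W] := admissible_linear lam_gt0.
have := r_min A; rewrite (Ihat_ae _ _ _ _ wg) (Ihat_ae _ _ _ _ W).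
rewrite leeD2rE ?fin_numN// => H; apply: (le_lt_trans H).
(* For the linear map r' and r/x are both lam, so its density is x^(n-1) times the density at x =
   1. *)
pose c := energy_density m.+2 kappa h (fun=> lam) (fun x => lam * x) 1.
have i1 : mu.-integrable `]0, 1[ (EFin \o (fun x => x ^+ m.+1 * c)).
{ apply: continuous_integrable_itvoo; apply: continuous_subspaceT => x.
  by apply: cvgM; [exact: exprn_continuous|exact: cvg_cst]. }
have E : (\int[mu]_(x in `]0%R, 1%R[) (energy_density m.+2 kappa h (fun=> lam) (fun x => lam *
  x) x)%:E
  = \int[mu]_(x in `]0%R, 1%R[) (x ^+ m.+1 * c)%:E)%E.
{ apply: eq_integral => x; rewrite inE /= in_itv /= => /andP[x0 x1]; congr EFin.
  by rewrite /c /energy_density mulfK ?gt_eqF// expr1n mul1r mulr1 divr1. }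
rewrite E; apply: (@integrable_lty _ (measurableTypeR R) R mu D01 (measurable_itv _) (EFin \o
  (fun x => x ^+ m.+1 * c))); exact: i1.
Qed.

Lemma terms_integrable : [/\ mu.-integrable D01 (EFin \o grad_term g),
  mu.-integrable D01 (EFin \o bulk_term r g) & mu.-integrable D01 (EFin \o log_term r g)].
Proof.
have I := Ihat_finite.
apply: (@integrable_of_sum R D01 _ _ _ (fun x => kappa * m.+1%:R * lam ^+ m * g x)) => //.
{ exact: measurable_grad_term g_measurable. }
{ exact: measurable_bulk_term g_measurable radial_continuous g_gt0 radial_gt0_oo. }
{ exact: measurable_log_term g_measurable radial_continuous. }
{ by apply: integrableZl_EFin => //; exact: integrableT_sub. }
{ by move=> x /=; rewrite in_itv /=; exact: grad_term_ge0. }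
{ by move=> x /=; rewrite in_itv /=; exact: bulk_term_ge0 g_gt0 radial_gt0_oo _. }
{ by move=> x _; rewrite !mulr_ge0// ?exprn_ge0// ltW. }
{ move=> x /=; rewrite in_itv /= => x01; apply: (log_term_ge g_gt0 radial_gt0_oo x01).
  by apply: radial_le_lam; case/andP: x01 => ? ?; rewrite !ltW. }
apply: le_lt_trans I; rewrite le_eqVlt; apply/orP; left; apply/eqP.
by apply: eq_integral => x _; rewrite energy_densityE.
Qed.

Variables (K gamma0 : R).
Hypotheses (K0 : 0 < K) (gamma00 : 0 < gamma0).
Hypothesis h_growth : forall d c : R, 0 < d -> 0 < c -> `|c - 1| <= gamma0 ->
       `|d * h^`()%classic (c * d)| <= K * (h d + 1).

Definition stress_term x := x ^+ m.+1 * (det_of r g x * h^`()%classic (det_of r g x)).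
(* If L is the integrand of [Ihat], then [slope_coef] is r' * dL/dr' and
   [value_coef] is r * dL/dr. *)
Definition slope_coef x := m.+2%:R * grad_term g x + stress_term x + log_term r g x.
Definition value_coef x := m.+1%:R * (stress_term x + log_term r g x) + kappa * m.+1%:R * (x ^+
  m.+1 * det_of r g x).

Let det_of_pos x : 0 < x < 1 -> 0 < det_of r g x.
Proof. exact: det_of_gt0 g_gt0 radial_gt0_oo x. Qed.

Lemma Xn_det_of_integrable : mu.-integrable D01 (EFin \o (fun x => x ^+ m.+1 * det_of r g x)).
Proof.
apply: (@eq_integrable_EFin _ (measurableTypeR R) R mu _ _ (fun x => r x ^+ m.+1 * g x)) => //.
{ by move=> x /=; rewrite in_itv /= => /andP[x0 x1]; rewrite Xn_det_ofE. }
apply: (@integrableM_bounded _ (measurableTypeR R) R mu _ _ (lam ^+ m.+1)) => //.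
{ apply: measurable_funX; apply: open_continuous_measurable_fun; first exact: interval_open.
  move=> x; rewrite inE /= in_itv /= => x01; exact: (within_interior_continuous
    radial_continuous x01). }
{ exact: integrableT_sub. }
move=> x /=; rewrite in_itv /= => x01; have rx := radial_gt0_oo x01.
rewrite normrX (gtr0_norm rx); apply: lerXn2r; rewrite ?nnegrE ?(ltW rx) ?(ltW lam_gt0)//.
by apply: radial_le_lam; case/andP: x01 => ? ?; rewrite !ltW.
Qed.

Lemma Xn_integrable : mu.-integrable D01 (EFin \o (fun x : R => x ^+ m.+1)).
Proof.
apply: continuous_integrable_itvoo; apply: continuous_subspaceT => x; exact: exprn_continuous.
Qed.

(** The growth condition with c = 1 bounds delta h'(delta) by K (h(delta) + 1), whose weighted
    integral is finite. *)
Lemma stress_term_integrable : mu.-integrable D01 (EFin \o stress_term).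
Proof.
have [_ i2 _] := terms_integrable.
have mdl := measurable_det_of g_measurable radial_continuous.
apply: (@le_integrable_EFin _ (measurableTypeR R) R mu _ _ _ (fun x => K * (bulk_term r g x + x
  ^+ m.+1))) => //.
{ apply: measurable_funM; first exact: measurable_Xn.
  by apply: measurable_funM => //; apply: measurable_comp_pos. }
{ apply: integrableZl_EFin => //; apply: integrableD_EFin => //; exact: Xn_integrable. }
move=> x /=; rewrite in_itv /= => x01; have x0 : 0 <= x by case/andP: x01 => /ltW.
rewrite /stress_term normrM (ger0_norm (exprn_ge0 _ x0)) /bulk_term -[X in _ + X]mulr1 -mulrDr
  mulrCA.
rewrite ler_wpM2l ?exprn_ge0//.
have := h_growth (det_of_pos x01) ltr01; rewrite subrr normr0 mul1r; apply; exact: ltW.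
Qed.

Lemma slope_coef_integrable : mu.-integrable D01 (EFin \o slope_coef).
Proof.
have [i1 i2 i3] := terms_integrable; have iX := stress_term_integrable.
by apply: integrableD_EFin => //; apply: integrableD_EFin => //; apply: integrableZl_EFin.
Qed.

Lemma value_coef_integrable : mu.-integrable D01 (EFin \o value_coef).
Proof.
have [i1 i2 i3] := terms_integrable; have iX := stress_term_integrable; have iY :=
  Xn_det_of_integrable.
by apply: integrableD_EFin => //; apply: integrableZl_EFin => //; apply: integrableD_EFin.
Qed.

(** * Multiplicative variations that vanish near the origin *)

Section perturbation.
Variables (a M : R) (w : R -> R).
Hypotheses (a01 : 0 < a < 1) (mw : measurable_fun (setT : set (measurableTypeR R)) w).
Hypotheses (M0 : 0 <= M) (wM : forall x, `|w x| <= M) (wa : forall x, x <= a -> w x = 0).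
Hypothesis w0 : prim (fun t => w t * g t) 1 = 0.

Let v t := w t * g t.
Let phi := prim v.

Lemma variation_integrable : mu.-integrable setT (EFin \o v).
Proof. by apply: (@integrableM_bounded _ (measurableTypeR R) R mu _ _ M) => // x _; exact: wM.
  Qed.

Lemma variation_eq0 x : 0 <= x <= a -> phi x = 0.
Proof.
move=> /andP[x0 xa]; rewrite /phi /prim.
transitivity (\int[mu]_(t in `[0, x]) 0 : R); last by rewrite Rintegral_cst_itv// mul0r.
apply: eq_Rintegral => t; rewrite inE /= in_itv /= => /andP[t0 tx].
by rewrite /v wa ?mul0r// (le_trans tx).
Qed.

Lemma variation_bound x : 0 <= x <= 1 -> `|phi x| <= M * lam.
Proof.
move=> x01; have [x0 x1] := andP x01; rewrite /phi /prim.
have iv : mu.-integrable `[0, x] (EFin \o v) by apply: integrableT_sub => //; exact: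
  variation_integrable.
have ig : mu.-integrable `[0, x] (EFin \o g) by exact: integrableT_sub.
apply: (le_trans (@le_normr_Rintegral _ (measurableTypeR R) R mu _ _ (measurable_itv _) iv)).
apply: (@le_trans _ _ (\int[mu]_(t in `[0, x]) (M * g t))).
{ apply: le_Rintegral => //; first exact: integrable_norm.
  { exact: integrableZl_EFin. }
  by move=> t _; rewrite normrM (ger0_norm (g_ge0 t)) ler_wpM2r. }
rewrite RintegralZl// ler_wpM2l//.
have := radial_le_lam x01; rewrite rE// /prim; have := r0; lra.
Qed.

Let rho x := phi x / r x.
Let B := Num.max 1 (Num.max M (M * lam / r a)).

(** On (0,a] phi vanishes, and beyond a the increasing function r is at least r(a) > 0. The entry M
    of [B] bounds w as well, and the entry 1 meets the requirement of [dperturbed_bound]. *)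
Lemma rho_bound x : 0 < x < 1 -> `|rho x| <= B.
Proof.
move=> x01; have [x0 x1] := andP x01; have [a0 a1] := andP a01.
have ra := radial_gt0_oo a01; have rx := radial_gt0_oo x01.
case: (lerP x a) => xa.
{ by rewrite /rho variation_eq0 ?(ltW x0)// mul0r normr0 le_max ler01. }
rewrite !le_max; apply/orP; right; apply/orP; right.
rewrite /rho normrM; apply: ler_pM => //; first by apply: variation_bound; rewrite !ltW.
rewrite normfV gtr0_norm// lef_pV2 ?posrE// radial_le ?ltW//.
Qed.

Let S t x := r x + t * phi x.
Let G t x := g x * (1 + t * w x).

Lemma varied_slope_integrable t : mu.-integrable setT (EFin \o G t).
Proof.
apply: (@eq_integrable_EFin _ (measurableTypeR R) R mu _ _ (fun x => g x + t * v x)) => //.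
{ by move=> x _; rewrite /G /v; ring. }
apply: integrableD_EFin => //; apply: integrableZl_EFin => //; exact: variation_integrable.
Qed.

Lemma varied_radialE t x : 0 <= x <= 1 -> S t x = r 0 + prim (G t) x.
Proof.
move=> x01; rewrite /S rE// -addrA; congr (_ + _).
have iv : mu.-integrable `[0, x] (EFin \o v) by apply: integrableT_sub => //; exact:
  variation_integrable.
have ig : mu.-integrable `[0, x] (EFin \o g) by exact: integrableT_sub.
rewrite /phi /prim -RintegralZl// -RintegralD//; last exact: integrableZl_EFin.
by apply: eq_Rintegral => y _; rewrite /G /v; ring.
Qed.

(** Since r + t phi = r (1 + t rho), every argument of the integrand changes by a factor and the
    logarithm splits. *)
Lemma perturbed_density t x : 0 < x < 1 -> 0 < 1 + t * rho x ->
  energy_density m.+2 kappa h (G t) (S t) x =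
  perturbed m kappa h (grad_term g x) (log_term r g x) (x ^+ m.+1) (det_of r g x) (w x) (rho x) t.
Proof.
move=> x01 tr; have rx := radial_gt0_oo x01; have x0 : 0 < x by case/andP: x01.
have q0 : 0 < r x / x by rewrite divr_gt0.
have Sx : S t x / x = r x / x * (1 + t * rho x).
{ by rewrite /S /rho; field; rewrite !gt_eqF. }
have dE : G t x * (S t x / x) ^+ m.+1 = det_of r g x * stretch m (w x) (rho x) t.
{ by rewrite Sx exprMn /G /det_of /stretch; ring. }
rewrite /energy_density /= dE Sx lnM ?posrE// /perturbed /grad_term /log_term /G exprMn.
have -> : m.+2%:R - 1 = m.+1%:R :> R by rewrite mulrSr addrK.
move: (stretch _ _ _ _) (h _) (ln (r x / x)) (ln _) (m.+2%:R^-1) ((1 + t * w x) ^+ _) => *; ring.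
Qed.

Lemma weak_inequality :
  mu.-integrable D01 (EFin \o (fun x => slope_coef x * w x + value_coef x / r x * phi x)) /\
  0 <= \int[mu]_(x in `]0, 1[) (slope_coef x * w x + value_coef x / r x * phi x).
Proof.
have B1 : 1 <= B by rewrite le_max lexx.
have B0 : 0 < B by exact: lt_le_trans B1.
have [eps [C [e0 C0 eB bd]]] := dperturbed_bound m kappa_gt0 h_ge0 K0 gamma00 h_growth B1.
have wB x : `|w x| <= B by rewrite !le_max wM orbT.
have pos v' s : `|v'| <= B -> 0 <= s <= eps -> 0 < 1 + s * v'.
{ move=> vB /andP[s0 se]; have : `|s * v'| <= 2^-1.
  { rewrite normrM (ger0_norm s0); apply: le_trans eB; apply: ler_pM => //. }
  rewrite ler_norml; lra. }
have [i1 i2 i3] := terms_integrable.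
pose e t x := perturbed m kappa h (grad_term g x) (log_term r g x) (x ^+ m.+1) (det_of r g x)
  (w x) (rho x) t.
pose e' t x := dperturbed m kappa h (grad_term g x) (log_term r g x) (x ^+ m.+1) (det_of r g x)
  (w x) (rho x) t.
(* The dominating function for the first variation: a combination of quantities already known to be
   integrable along the minimizer. *)
pose H x := C * (grad_term g x + x ^+ m.+1 * (h (det_of r g x) + 1) + `|log_term r g x| + x ^+
  m.+1 * det_of r g x).
have eE t x : 0 <= t <= eps -> D01 x -> energy_density m.+2 kappa h (G t) (S t) x = e t x.
{ move=> tI /=; rewrite in_itv /= => x01; apply: perturbed_density => //.
  by apply: pos => //; exact: rho_bound. }
have Gp t x : 0 <= t <= eps -> 0 < x < 1 -> 0 < G t x.
{ by move=> tI x01; rewrite mulr_gt0 ?g_gt0// pos. }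
have Sp t x : 0 <= t <= eps -> 0 < x < 1 -> 0 < S t x.
{ move=> tI x01; have rx := radial_gt0_oo x01.
  have -> : S t x = r x * (1 + t * rho x) by rewrite /S /rho; field; rewrite gt_eqF.
  by rewrite mulr_gt0// pos// rho_bound. }
have Sc t : {within `[0, 1], continuous (S t)}.
{ by have [] := W11_prim (varied_slope_integrable t) (varied_radialE t). }
have [] := @first_variation_ge0 R D01 e e' H eps (measurable_itv _) e0.
{ move=> t tI.
  apply: (@eq_measurable_fun _ _ (measurableTypeR R) (measurableTypeR R) _ (energy_density m.+2
    kappa h (G t) (S t))).
  { by move=> x; rewrite inE => x01; rewrite eE. }
  apply: measurable_density => //.
  { by apply: measurable_funTS; exact: integrable_EFin_measurable (varied_slope_integrable t). }
  { by move=> x; exact: Gp. }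
  { by move=> x; exact: Sp. } }
{ apply: integrableZl_EFin => //; apply: integrableD_EFin => //; last exact: Xn_det_of_integrable.
  apply: integrableD_EFin => //; last exact: integrable_norm.
  apply: integrableD_EFin => //.
  apply: (@eq_integrable_EFin _ (measurableTypeR R) R mu _ _ (fun x => bulk_term r g x + x ^+
    m.+1)) => //.
  { by move=> x _; rewrite /bulk_term mulrDr mulr1. }
  apply: integrableD_EFin => //; exact: Xn_integrable. }
{ move=> x t /=; rewrite in_itv /= => x01 tI; apply: is_derive_perturbed => //; first exact:
  det_of_pos.
  { exact: pos. }
  by apply: pos => //; exact: rho_bound. }
{ move=> x t /=; rewrite in_itv /= => x01 tI; apply: bd => //; last exact: rho_bound.
  { exact: grad_term_ge0. }
  { by apply: exprn_ge0; case/andP: x01 => /ltW. }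
  exact: det_of_pos. }
{ apply: (@eq_integrable_EFin _ (measurableTypeR R) R mu _ _ (fun x => grad_term g x +
  bulk_term r g x + log_term r g x)) => //.
  { by move=> x _; rewrite /e perturbed0. }
  by apply: integrableD_EFin => //; apply: integrableD_EFin. }
(* The varied map is an admissible competitor: its slope [G t] is positive, its value at 0 is still
   r(0), and phi(1) = 0 preserves the value lam at 1. *)
{ move=> t tI.
  have [||||A W] := @admissible_prim R lam (r 0) (S t) (G t) (varied_slope_integrable t).
  { by move=> x; exact: Gp. }
  { by move=> x; exact: varied_radialE. }
  { exact: r0. }
  { by rewrite /S r1 /phi w0 mulr0 addr0. }
  have := r_min A; rewrite (Ihat_ae _ _ _ _ wg) (Ihat_ae _ _ _ _ W) leeD2rE ?fin_numN//.
  have -> : (\int[mu]_(x in `]0%R, 1%R[) (energy_density m.+2 kappa h g r x)%:E = \int[mu]_(x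
    in `]0%R, 1%R[) (e 0 x)%:E)%E.
  { by apply: eq_integral => x _; rewrite /e perturbed0 energy_densityE. }
  have -> // : (\int[mu]_(x in `]0%R, 1%R[) (energy_density m.+2 kappa h (G t) (S t) x)%:E =
    \int[mu]_(x in `]0%R, 1%R[) (e t x)%:E)%E.
  by apply: eq_integral => x; rewrite inE => x01; rewrite eE. }
have eq0 x : D01 x -> e' 0 x = slope_coef x * w x + value_coef x / r x * phi x.
{ move=> _; rewrite /e' dperturbed0 /slope_coef /value_coef /stress_term /rho.
  ring. }
move=> ie I0; split; first exact: (@eq_integrable_EFin _ (measurableTypeR R) R mu _ _ (e' 0)).
apply: (le_trans I0); rewrite le_eqVlt; apply/orP; left; apply/eqP.
by apply: eq_Rintegral => x; rewrite inE => x01; rewrite eq0.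
Qed.

End perturbation.

(** The conditions on w are stable under sign change and the variation is linear in w, so the
    inequalities for w and -w combine. *)
Lemma weak_equality (a M : R) (w : R -> R) : 0 < a < 1 ->
  measurable_fun (setT : set (measurableTypeR R)) w ->
  0 <= M -> (forall x, `|w x| <= M) -> (forall x, x <= a -> w x = 0) ->
  prim (fun t => w t * g t) 1 = 0 ->
  mu.-integrable D01 (EFin \o (fun x => slope_coef x * w x + value_coef x / r x * prim (fun t
    => w t * g t) x)) /\
  \int[mu]_(x in `]0, 1[) (slope_coef x * w x + value_coef x / r x * prim (fun t => w t * g t)
    x) = 0.
Proof.
move=> a01 mw M0 wM wa w0.
have [i I1] := weak_inequality a01 mw M0 wM wa w0.
have pN x : prim (fun t => - w t * g t) x = - prim (fun t => w t * g t) x.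
{ have iv : mu.-integrable `[0, x] (EFin \o (fun t => w t * g t)).
  { by apply: integrableT_sub => //; exact: variation_integrable mw wM. }
  rewrite /prim -mulN1r -RintegralZl//; apply: eq_Rintegral => t _; ring. }
have [||||_ I2] := @weak_inequality a M (fun x => - w x) a01 _ M0.
{ exact: measurable_funN. }
{ by move=> x; rewrite normrN. }
{ by move=> x /wa ->; rewrite oppr0. }
{ by rewrite pN w0 oppr0. }
split => //; apply/eqP; rewrite eq_le I1 andbT -oppr_ge0; apply: (le_trans I2).
rewrite -mulN1r -RintegralZl// le_eqVlt; apply/orP; left; apply/eqP.
by apply: eq_Rintegral => x _; rewrite pN; ring.
Qed.

(** A du Bois-Reymond argument with weight g. After integration by parts, [slope_coef - prim b * g]
    is orthogonal to every bounded w supported in (a,1) with int w g = 0, so there it is a constant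
    multiple of g. Here b is dL/dr on (a,1). *)
Lemma Euler_Lagrange_ae (a : R) : 0 < a < 1 ->
  exists (b : R -> R) (C : R), [/\ mu.-integrable setT (EFin \o b),
    forall x, a < x < 1 -> b x = value_coef x / r x &
    {ae mu, forall x, a < x < 1 -> slope_coef x = (prim b x + C) * g x}].
Proof.
move=> a01; have [a0 a1] := andP a01; have ra := radial_gt0_oo a01.
pose chi x : R := if a < x then 1 else 0.
have mchi : measurable_fun (setT : set (measurableTypeR R)) chi.
{ by apply: measurable_fun_ifT => //; exact: measurable_fun_ltr. }
have mchi' : measurable_fun D01 chi by exact: measurable_funTS.
have chi1 x : `|chi x| <= 1 by rewrite /chi; case: ifP => _; rewrite ?normr1 ?normr0.
have chiK x : chi x * chi x = chi x by rewrite /chi; case: ifP => _; rewrite ?mulr1 ?mulr0.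
have Ichi (u : R -> R) : mu.-integrable D01 (EFin \o u) -> mu.-integrable D01 (EFin \o (fun x
  => chi x * u x)).
{ by move=> iu; apply: (@integrableM_bounded _ (measurableTypeR R) R mu _ _ 1). }
have ig : mu.-integrable D01 (EFin \o g) by exact: integrableT_sub.
(* The cut-off [chi] removes a neighbourhood of 0, where 1/r may be unbounded; on the rest 1/r is at
   most 1/r(a). *)
have ib : mu.-integrable D01 (EFin \o (fun x => chi x / r x * value_coef x)).
{ apply: (@integrableM_bounded _ (measurableTypeR R) R mu _ _ (r a)^-1) => //.
  { apply: measurable_funM => //; apply: open_continuous_measurable_fun; first exact:
    interval_open.
    move=> x; rewrite inE /= in_itv /= => x01; apply: cvgV; first by rewrite gt_eqF//
      radial_gt0_oo.
    exact: (within_interior_continuous radial_continuous x01). }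
  { exact: value_coef_integrable. }
  move=> x /=; rewrite in_itv /= => x01; have rx := radial_gt0_oo x01; rewrite /chi; case: ifPn
    => ax.
  { rewrite div1r normfV gtr0_norm// lef_pV2 ?posrE// radial_le ?ltW//; by case/andP: x01. }
  by rewrite mul0r normr0 invr_ge0 ltW. }
pose b := (fun x => chi x / r x * value_coef x) \_ D01.
have bi : mu.-integrable setT (EFin \o b) by exact: integrable_restr.
have bE x : 0 < x < 1 -> b x = chi x / r x * value_coef x.
{ by move=> x01; rewrite /b patchE mem_set//= in_itv. }
pose W := prim b.
have cW : {within `[0, 1], continuous W} by exact: prim_continuous.
have iWg : mu.-integrable D01 (EFin \o (fun x => W x * g x)).
{ apply: (@integrableS _ (measurableTypeR R) R mu `[0%R, 1%R]%classic) => //; first exact: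
  subset_itv_oo_cc.
  apply: integrableM_continuous => //; exact: integrableT_sub. }
have Ig_gt0 : 0 < \int[mu]_(x in `]0, 1[) (chi x * g x).
{ rewrite lt_neqAle Rintegral_ge0 ?andbT; last first.
  { by move=> x _; rewrite mulr_ge0// /chi; case: ifP. }
  apply/eqP => /esym I0.
  have chi_ge0 x : 0 <= chi x by rewrite /chi; case: ifP.
  have H := @Rintegral0_ae R D01 _ (measurable_itv _) (Ichi _ ig)
    (fun x _ => mulr_ge0 (chi_ge0 x) (g_ge0 x)) I0.
  apply: (not_ae_itv a1); apply: (ae_imply H) => x Hx /andP[ax x1].
  have : chi x * g x = 0 by apply: Hx; rewrite /= in_itv /= x1 (lt_trans a0).
  rewrite /chi ax mul1r => gx; have := g_gt0 (x := x).
  by rewrite gx ltxx x1 (lt_trans a0 ax) => /(_ isT). }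
pose F x := slope_coef x - W x * g x.
have iF : mu.-integrable D01 (EFin \o F) by apply: integrableB_EFin => //; exact:
  slope_coef_integrable.
(* If F is a multiple of g on (a,1), the factor must be this quotient of integrals. *)
pose C := (\int[mu]_(x in `]0, 1[) (chi x * F x)) / \int[mu]_(x in `]0, 1[) (chi x * g x).
(* It remains to see that [q], which has mean zero, vanishes. The bounded weight
   [w] below is the sign of [q] corrected by a constant so as to be admissible;
   testing with it gives that the integral of [`|q|] is zero. *)
pose q x := chi x * F x - C * (chi x * g x).
have iq : mu.-integrable D01 (EFin \o q).
{ by apply: integrableB_EFin => //; [exact: Ichi|apply: integrableZl_EFin => //; exact: Ichi]. }
have q0 : \int[mu]_(x in `]0, 1[) q x = 0.
{ rewrite RintegralB//; [|exact: Ichi|by apply: integrableZl_EFin => //; exact: Ichi].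
  rewrite RintegralZl//; last exact: Ichi.
  by rewrite /C divfK ?subrr// gt_eqF. }
pose w1 x := Num.sg ((q \_ D01) x).
have mw1 : measurable_fun (setT : set (measurableTypeR R)) w1.
{ have mq : measurable_fun (setT : set (measurableTypeR R)) (q \_ D01).
  { by apply: integrable_EFin_measurable; apply: integrable_restr. }
  rewrite (_ : w1 = fun x => if (q \_ D01) x == 0 then 0 else if (q \_ D01) x < 0 then -1 else
    1); last first.
  { by apply/funext => x; rewrite /w1; case: sgrP. }
  apply: measurable_fun_ifT => //; first exact: measurable_fun_eqr.
  by apply: measurable_fun_ifT => //; exact: measurable_fun_ltr. }
have w1b x : `|w1 x| <= 1 by rewrite /w1 normr_sg; case: (_ != 0).
have iw1 : mu.-integrable D01 (EFin \o (fun x => chi x * (w1 x * g x))).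
{ apply: Ichi; apply: (@integrableM_bounded _ (measurableTypeR R) R mu _ _ 1) => //; exact:
  measurable_funTS. }
(* The constant for which w g has integral zero. *)
pose c := (\int[mu]_(x in `]0, 1[) (chi x * (w1 x * g x))) / \int[mu]_(x in `]0, 1[) (chi x * g
  x).
pose w x := chi x * (w1 x - c).
have mw : measurable_fun (setT : set (measurableTypeR R)) w.
{ by apply: measurable_funM => //; apply: measurable_funB. }
have M0 : 0 <= 1 + `|c| by rewrite addr_ge0.
have wM x : `|w x| <= 1 + `|c|.
{ rewrite normrM -[leRHS]mul1r; apply: ler_pM => //.
  by apply: (le_trans (ler_normB _ _)); rewrite lerD2r. }
have wa x : x <= a -> w x = 0 by move=> xa; rewrite /w /chi ltNge xa mul0r.
have Iwg : \int[mu]_(x in `]0, 1[) (w x * g x) = 0.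
{ transitivity (\int[mu]_(x in `]0, 1[) (chi x * (w1 x * g x) - c * (chi x * g x))).
  { by apply: eq_Rintegral => x _; rewrite /w; ring. }
  rewrite RintegralB//; last by apply: integrableZl_EFin => //; exact: Ichi.
  rewrite RintegralZl//; last exact: Ichi.
  by rewrite /c divfK ?subrr// gt_eqF. }
have w0 : prim (fun t => w t * g t) 1 = 0 by rewrite /prim -Rintegral_oo_cc.
have [J I1] := weak_equality a01 mw M0 wM wa w0.
have ivT : mu.-integrable setT (EFin \o (fun t => w t * g t)) by exact: variation_integrable mw
  wM.
have iv := @integrableT_sub R _ D01 (measurable_itv _) ivT.
set phi := prim _ in J I1.
(* The boundary term drops because phi(1) = 0; the integral of b phi becomes minus that of W w g. *)
have I2 := prim_by_parts bi ivT; rewrite w0 mulr0 -/phi -!Rintegral_oo_cc in I2.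
have cphi : {within `[0, 1], continuous phi} by exact: prim_continuous.
have ibphi : mu.-integrable D01 (EFin \o (fun x => b x * phi x)).
{ apply: (@integrableS _ (measurableTypeR R) R mu `[0%R, 1%R]%classic) => //; first exact:
  subset_itv_oo_cc.
  apply: (@eq_integrable_EFin _ (measurableTypeR R) R mu _ _ (fun x => phi x * b x)) => //.
  { by move=> x _; rewrite mulrC. }
  apply: integrableM_continuous => //; exact: integrableT_sub. }
have bphi x : 0 < x < 1 -> value_coef x / r x * phi x = b x * phi x.
{ move=> x01; have [x0 x1] := andP x01; rewrite bE// /chi; case: ltrP => ax; first by ring.
  by rewrite /phi (variation_eq0 wa) ?mulr0// ltW. }
have iEw : mu.-integrable D01 (EFin \o (fun x => slope_coef x * w x)).
{ apply: (@eq_integrable_EFin _ (measurableTypeR R) R mu _ _ (fun x => w x * slope_coef x)) => //.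
  { by move=> x _; rewrite mulrC. }
  apply: (@integrableM_bounded _ (measurableTypeR R) R mu _ _ (1 + `|c|)) => //; last exact:
    slope_coef_integrable.
  exact: measurable_funTS. }
have I3 : \int[mu]_(x in `]0, 1[) (slope_coef x * w x) = \int[mu]_(x in `]0, 1[) (W x * (w x *
  g x)).
{ have : \int[mu]_(x in `]0, 1[) (slope_coef x * w x) + \int[mu]_(x in `]0, 1[) (b x * phi x) = 0.
  { rewrite -RintegralD// -[RHS]I1; apply: eq_Rintegral => x; rewrite inE /= in_itv /= => x01.
    by rewrite bphi. }
  move: I2; rewrite -/W; lra. }
have iWw : mu.-integrable D01 (EFin \o (fun x => W x * (w x * g x))).
{ apply: (@eq_integrable_EFin _ (measurableTypeR R) R mu _ _ (fun x => w x * (W x * g x))) => //.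
  { by move=> x _; ring. }
  apply: (@integrableM_bounded _ (measurableTypeR R) R mu _ _ (1 + `|c|)) => //.
  exact: measurable_funTS. }
have I4 : \int[mu]_(x in `]0, 1[) `|q x| = 0.
(* On (a,1), w1 = w + c gives |q| = q w1 = F w - C w g + c q, and the three integrals vanish by
   [I3], [Iwg] and [q0]. *)
{ transitivity (\int[mu]_(x in `]0, 1[) ((slope_coef x * w x - W x * (w x * g x)) - C * (w x *
  g x) + c * q x)).
  { apply: eq_Rintegral => x; rewrite inE => Dx.
    have -> : `|q x| = q x * w1 x by rewrite /w1 patchE mem_set// mulrC -normrEsg.
    rewrite /w /q /F /chi; case: ifP => _; ring. }
  rewrite RintegralD//; [|by apply: integrableB_EFin => //; [exact: integrableB_EFin|exact:
    integrableZl_EFin]|exact: integrableZl_EFin].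
  rewrite RintegralB//; [|exact: integrableB_EFin|exact: integrableZl_EFin].
  by rewrite RintegralB// !RintegralZl// q0 Iwg I3 subrr !mulr0 subr0 addr0. }
exists b, C; split => //.
{ move=> x /andP[ax x1]; rewrite bE ?x1 ?(lt_trans a0)// /chi ax; ring. }
have H := Rintegral0_ae (measurable_itv _) (integrable_norm iq) (fun x _ => normr_ge0 _) I4.
apply: (ae_imply H) => x Hx /andP[ax x1].
have : `|q x| = 0 by apply: Hx; rewrite /= in_itv /= x1 (lt_trans a0).
move/eqP; rewrite normr_eq0 /q /F /chi ax !mul1r => /eqP E.
by rewrite -/W; lra.
Qed.

End minimizer.
End weak_Euler_Lagrange.

(** * Regularity and the classical equation *)

Section regularity.
Context (R : realType).
Notation mu := (@lebesgue_measure R).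

Lemma derive1_gt0_lt (f : R -> R) (u v : R) :
  (forall x, u <= x <= v -> derivable f x 1) -> (forall x, u <= x <= v -> 0 < f^`()%classic x) ->
  u < v -> f u < f v.
Proof.
move=> df fp uv.
have [||c cI E] := @MVT R f f^`()%classic u v uv.
{ move=> x; rewrite in_itv /= => /andP[ux xv].
  by split; [apply: df; rewrite !ltW|rewrite derive1E]. }
{ apply: derivable_within_continuous => x; rewrite in_itv /=; exact: df. }
rewrite -subr_gt0 E mulr_gt0 ?subr_gt0//; apply: fp.
by move: cI; rewrite in_itv /= => /andP[? ?]; rewrite !ltW.
Qed.

(** An implicit function theorem from monotonicity alone: if k x v1 < 0 < k x v2, both signs persist
    at nearby y by continuity in x, and monotonicity traps the root between v1 and v2. *)
Lemma monotone_root_continuous (k : R -> R -> R) (a b : R) :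
  (forall x v, a < x < b -> 0 < v -> {for x, continuous (k ^~ v)}) ->
  (forall x u v, a < x < b -> 0 < u -> u < v -> k x u < k x v) ->
  (forall x, a < x < b -> exists2 v, 0 < v & k x v = 0) ->
  exists gam : R -> R, forall x, a < x < b ->
    [/\ 0 < gam x, k x (gam x) = 0 & {for x, continuous gam}].
Proof.
move=> kc km kr.
pose gam x := get [set v | 0 < v /\ k x v = 0].
have gamP x : a < x < b -> 0 < gam x /\ k x (gam x) = 0.
{ move=> xab; apply: (@getPex _ [set v | 0 < v /\ k x v = 0]).
  by have [v v0 kv] := kr x xab; exists v. }
exists gam => x xab; have [g0 gk] := gamP x xab; split => //.
have {}xab' := xab; have [ax xb] := andP xab.
apply/cvgrPdist_le => /= e e0.
(* The maximum with [gam x / 2] keeps v1 positive, inside the domain of the hypotheses. *)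
pose v1 := Num.max (gam x / 2) (gam x - e); pose v2 := gam x + e.
have v10 : 0 < v1 by rewrite lt_max divr_gt0.
have v1g : v1 < gam x by rewrite gt_max; apply/andP; split; lra.
have v1e : gam x - e <= v1 by rewrite le_max lexx orbT.
have gv2 : gam x < v2 by rewrite /v2; lra.
have v20 : 0 < v2 by exact: lt_trans gv2.
have k1 : k x v1 < 0 by rewrite -gk km.
have k2 : 0 < k x v2 by rewrite -gk km.
have c1 := kc x v1 xab v10; have c2 := kc x v2 xab v20.
near=> y.
have yab : a < y < b by apply/andP; split; near: y; [exact: lt_nbhsr|exact: lt_nbhsl].
have ky1 : k y v1 < 0 by near: y; apply: (cvgr_lt _ c1).
have ky2 : 0 < k y v2 by near: y; apply: (cvgr_gt _ c2).
have [gy0 gyk] := gamP y yab.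
have h1 : v1 < gam y.
{ rewrite ltNge; apply/negP; rewrite le_eqVlt => /predU1P[E|lt1].
  { by move: ky1; rewrite -E gyk ltxx. }
  by have := lt_trans (km y _ _ yab gy0 lt1) ky1; rewrite gyk ltxx. }
have h2 : gam y < v2.
{ rewrite ltNge; apply/negP; rewrite le_eqVlt => /predU1P[E|lt1].
  { by move: ky2; rewrite E gyk ltxx. }
  by have := lt_trans ky2 (km y _ _ yab v20 lt1); rewrite gyk ltxx. }
rewrite ler_norml; apply/andP; split; first by rewrite /v2 in h2; lra.
lra.
Unshelve. all: by end_near. Qed.

(** Near x the primitive of f is a constant plus the integral of the continuous [gam] from a point c
    in (a,x). The compact interval [c,u] is used because [gam] is only known to be continuous inside
    (a,b). *)
Lemma prim_is_derive (f gam : R -> R) (a b x : R) : mu.-integrable setT (EFin \o f) ->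
  0 <= a -> (forall y, a < y < b -> {for y, continuous gam}) ->
  {ae mu, forall y, a < y < b -> f y = gam y} ->
  a < x < b -> is_derive x (1 : R) (prim f) (gam x).
Proof.
move=> fi a0 gc fg /andP[ax xb].
pose c := (a + x) / 2; pose u := (x + b) / 2.
have ac : a < c by rewrite /c; lra.
have cx : c < x by rewrite /c; lra.
have xu : x < u by rewrite /u; lra.
have ub : u < b by rewrite /u; lra.
have gi : mu.-integrable `[c, u] (EFin \o gam).
{ apply: continuous_integrable_itv; apply: continuous_in_subspaceT => y.
  rewrite inE /= in_itv /= => /andP[cy yu]; apply: gc.
  by rewrite (lt_le_trans ac)// (le_lt_trans yu). }
have [] := @continuous_FTC1 R gam (BLeft c) x u xu gi _ _.
{ by move: (ltW cx). }
{ by apply: gc; rewrite ax. }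
set F := (fun y => _) => dF F'x.
have DF : is_derive x (1 : R) (fun y => prim f c + F y) (gam x).
{ have := is_deriveD (is_derive_cst (prim f c) x (1 : R)) (DeriveDef dF (erefl _)).
  by rewrite add0r -derive1E F'x. }
apply: near_eq_is_derive DF; near=> y.
have cy : c < y by near: y; exact: lt_nbhsr.
have yu : y < u by near: y; exact: lt_nbhsl.
have c0 : 0 <= c by rewrite (le_trans a0)// ltW.
rewrite /F; apply/eqP; rewrite addrC eq_sym -subr_eq prim_sub ?c0 ?(ltW cy)//.
apply/eqP; rewrite /Rintegral; congr fine; apply: ae_eq_integral_nonmeasurable.
apply: (ae_imply fg) => z fz /=; rewrite in_itv /= => /andP[cz zy]; congr EFin.
by apply: fz; rewrite (lt_le_trans ac cz) (le_lt_trans zy)// (lt_trans yu ub).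
Unshelve. all: by end_near. Qed.

(** Both derivatives are limits of the same quotients, which turns a partial derivative into a
    one-variable computation. *)
Lemma derive_along (V : normedModType R) (F : V -> R) (a e : V) (l : R) :
  is_derive (0 : R) (1 : R) (fun t : R => F (t *: e + a)) l -> 'D_e F a = l.
Proof.
move=> [_ <-]; rewrite /derive; apply: (f_equal (fun u : R -> R => lim (u @ 0^'))).
by apply/funext => t /=; rewrite addr0 !scale0r !add0r /GRing.scale /= mulr1.
Qed.

(** * Partial derivatives of the stored energy *)

Section Phi_partials.
Variables (m : nat) (kappa : R) (h : R -> R) (v q : R).
Hypothesis h_derivable : forall d : R, 0 < d -> derivable h d 1.
Hypotheses (v0 : 0 < v) (q0 : 0 < q).

Definition stretch_row : 'rV[R]_m.+2 := \row_(j < m.+2) (if j == 0%N :> nat then v else q).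

Lemma is_derive_h (f : R -> R) (t df : R) : 0 < f t -> is_derive t (1 : R) f df ->
  is_derive t (1 : R) (fun s => h (f s)) (h^`()%classic (f t) * df).
Proof.
move=> ft fd; have hd : is_derive (f t) (1 : R) h (h^`()%classic (f t)).
{ by split; [exact: h_derivable|rewrite derive1E]. }
exact: (@is_derive1_comp R h f t _ _ hd fd).
Qed.

Lemma is_derive_shiftX (c t : R) k :
  is_derive t (1 : R) (fun s => (s + c) ^+ k.+1) (k.+1%:R * (t + c) ^+ k).
Proof.
have H := is_deriveX k.+1 (is_deriveD (is_derive_id t (1:R)) (is_derive_cst c t (1:R))).
rewrite (_ : (fun s => _) = (id \+ cst c) ^+ k.+1); last by rewrite exprfctE.
by apply: is_derive_eq H _; rewrite addr0 /GRing.scale /= mulr1.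
Qed.

Lemma partial1E : partial (Phi kappa h) 1 stretch_row =
  kappa * v ^+ m.+1 + h^`()%classic (v * q ^+ m.+1) * q ^+ m.+1.
Proof.
apply: derive_along.
have -> : (fun t : R => Phi kappa h (t *: (\row_(j < m.+2) ((j.+1 == 1%N)%:R : R)) +
  stretch_row)) =
  (fun t => kappa / m.+2%:R * ((t + v) ^+ m.+2 + m.+1%:R * q ^+ m.+2) + h ((t + v) * q ^+ m.+1)).
{ apply/funext => t; rewrite /Phi [\sum_(_ < _) _]big_ord_recl [\prod_(_ < _) _]big_ord_recl
  !mxE /= mulr1.
  congr (_ * (_ + _) + h (_ * _)).
  { rewrite (eq_bigr (fun=> q ^+ m.+2)); first by rewrite sumr_const card_ord mulr_natl.
    by move=> i _; rewrite !mxE /= mulr0 add0r. }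
  rewrite (eq_bigr (fun=> q)); first by rewrite prodr_const card_ord.
  by move=> i _; rewrite !mxE /= mulr0 add0r. }
have D1 := is_deriveD (is_derive_shiftX v 0 m.+1) (is_derive_cst (m.+1%:R * q ^+ m.+2) (0:R)
  (1:R)).
have Ds : is_derive (0 : R) (1 : R) (fun t => (t + v) * q ^+ m.+1) (q ^+ m.+1).
{ have := is_deriveM (is_deriveD (is_derive_id (0:R) (1:R)) (is_derive_cst v (0:R) (1:R)))
  (is_derive_cst (q ^+ m.+1) (0:R) (1:R)).
  move=> H; apply: is_derive_eq H _; rewrite /GRing.scale /= ; ring. }
have D2 := is_derive_h _ Ds.
apply: is_derive_eq (is_deriveD (is_deriveZ (kappa / m.+2%:R) D1) (D2 _)) _.
{ by rewrite add0r mulr_gt0// exprn_gt0. }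
rewrite /GRing.scale /= !add0r addr0; congr (_ + _).
by rewrite mulrA divfK// pnatr_eq0.
Qed.

Lemma partial2E : partial (Phi kappa h) 2 stretch_row =
  kappa * q ^+ m.+1 + h^`()%classic (v * q ^+ m.+1) * (v * q ^+ m).
Proof.
apply: derive_along.
have -> : (fun t : R => Phi kappa h (t *: (\row_(j < m.+2) ((j.+1 == 2%N)%:R : R)) +
  stretch_row)) =
  (fun t => kappa / m.+2%:R * ((t + q) ^+ m.+2 + (v ^+ m.+2 + m%:R * q ^+ m.+2)) + h ((t + q) *
    (v * q ^+ m))).
{ apply/funext => t; rewrite /Phi !big_ord_recl !mxE /= mulr1 mulr0 add0r.
  congr (_ * _ + h _).
  { rewrite addrCA; congr (_ + (_ + _)).
    rewrite (eq_bigr (fun=> q ^+ m.+2)); first by rewrite sumr_const card_ord mulr_natl.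
    by move=> i _; rewrite !mxE /= mulr0 add0r. }
  rewrite mulrCA; congr (_ * (_ * _)).
  rewrite (eq_bigr (fun=> q)); first by rewrite prodr_const card_ord.
  by move=> i _; rewrite !mxE /= mulr0 add0r. }
have D1 := is_deriveD (is_derive_shiftX q 0 m.+1) (is_derive_cst (v ^+ m.+2 + m%:R * q ^+ m.+2)
  (0:R) (1:R)).
have Ds : is_derive (0 : R) (1 : R) (fun t => (t + q) * (v * q ^+ m)) (v * q ^+ m).
{ have := is_deriveM (is_deriveD (is_derive_id (0:R) (1:R)) (is_derive_cst q (0:R) (1:R)))
  (is_derive_cst (v * q ^+ m) (0:R) (1:R)).
  move=> H; apply: is_derive_eq H _; rewrite /GRing.scale /= ; ring. }
have D2 := is_derive_h _ Ds.
apply: is_derive_eq (is_deriveD (is_deriveZ (kappa / m.+2%:R) D1) (D2 _)) _.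
{ by rewrite add0r !mulr_gt0// exprn_gt0. }
rewrite /GRing.scale /= !add0r addr0; congr (_ + _).
{ by rewrite mulrA divfK// pnatr_eq0. }
by congr (h^`()%classic _ * _); rewrite exprS; ring.
Qed.

End Phi_partials.
End regularity.

(** * From the integrated to the classical equation *)

Section classical.
Context (R : realType).
Notation mu := (@lebesgue_measure R).
Notation D01 := (`]0%R, 1%R[%classic : set (measurableTypeR R)).

(* [x ^+ n.-1 * Phi_,1] with [n = m.+2], [r x = rx] and slope [v]. *)
Definition psi (m : nat) (kappa : R) (h : R -> R) (rx x v : R) : R :=
  kappa * x ^+ m.+1 * v ^+ m.+1 + rx ^+ m.+1 * h^`()%classic (v * (rx / x) ^+ m.+1).

(** Strictness comes from h'' > 0, which makes h' strictly increasing; the power term contributes a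
    weak inequality. *)
Lemma psi_lt (m : nat) (kappa : R) (h : R -> R) (rx x u v : R) : 0 < kappa ->
  (forall d : R, 0 < d -> derivable h^`() d 1) ->
  (forall d : R, 0 < d -> 0 < h^`(2) d) ->
  0 < rx -> 0 < x -> 0 < u -> u < v -> psi m kappa h rx x u < psi m kappa h rx x v.
Proof.
move=> k0 hd hp rx0 x0 u0 uv; have q0 : 0 < (rx / x) ^+ m.+1 by rewrite exprn_gt0// divr_gt0.
apply: ler_ltD.
{ rewrite ler_wpM2l//; first by rewrite mulr_ge0 ?exprn_ge0 ?ltW.
  by apply: lerXn2r; rewrite ?nnegrE ?ltW// (lt_trans u0). }
rewrite ltr_pM2l ?exprn_gt0//; apply: derive1_gt0_lt.
{ by move=> y /andP[y0 _]; apply: hd; rewrite (lt_le_trans _ y0)// mulr_gt0. }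
{ move=> y /andP[y0 _]; have := hp y; rewrite derive1nS derive1n1; apply.
  by rewrite (lt_le_trans _ y0)// mulr_gt0. }
by rewrite ltr_pM2r.
Qed.

Lemma psi_root (m : nat) (kappa : R) (h : R -> R) (rx x c : R) : 0 < kappa ->
  (forall d : R, 0 < d -> {for d, continuous h^`()}) ->
  h^`()%classic d @[d --> 0^'+] --> -oo ->
  h^`()%classic d @[d --> +oo] --> +oo ->
  0 < rx -> 0 < x -> exists2 v, 0 < v & psi m kappa h rx x v = c.
Proof.
move=> k0 hc h0 hoo rx0 x0; set q := (rx / x) ^+ m.+1.
have q0 : 0 < q by rewrite exprn_gt0// divr_gt0.
have r0 : 0 < rx ^+ m.+1 by rewrite exprn_gt0.
have x0' : 0 < x ^+ m.+1 by rewrite exprn_gt0.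
(* For a slope at most 1 the power term is at most kappa x^(m+1), so h' <= A brings [psi] down to
   c. *)
pose A := (c - kappa * x ^+ m.+1) / rx ^+ m.+1.
have [d0 d00 Hd0] : exists2 d0 : R, 0 < d0 & forall d, 0 < d -> d < d0 -> h^`()%classic d <= A.
{ have /cvgrNyPle/(_ A) [e /= e0 He] := h0.
  by exists e => // d dp de; apply: He => //=; rewrite sub0r normrN gtr0_norm. }
have [D HD] : exists D : R, forall d, D < d -> c / rx ^+ m.+1 <= h^`()%classic d.
{ have /cvgryPge/(_ (c / rx ^+ m.+1)) [D [_ HD]] := hoo.
  by exists D => d Dd; apply: HD. }
pose v1 := Num.min 1 (d0 / 2 / q).
have v10 : 0 < v1 by rewrite lt_min ltr01 !divr_gt0.
have v11 : v1 <= 1 by rewrite ge_min lexx.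
have v1q : v1 * q < d0.
{ apply: (@le_lt_trans _ _ (d0 / 2)); last by lra.
  by rewrite -ler_pdivlMr// ge_min lexx orbT. }
(* Here h' alone pushes [psi] above c, the power term being nonnegative; the entry 1 ensures v1 <=
   v2. *)
pose v2 := Num.max 1 ((`|D| + 1) / q).
have v12 : v1 <= v2 by rewrite (le_trans v11)// le_max lexx.
have v20 : 0 < v2 by exact: lt_le_trans v12.
have v2q : D < v2 * q.
{ apply: (@lt_le_trans _ _ (`|D| + 1)); first by rewrite (le_lt_trans (ler_norm D))// ltrDl.
  by rewrite -ler_pdivrMr// le_max lexx orbT. }
have p1 : psi m kappa h rx x v1 <= c.
{ apply: (@le_trans _ _ (kappa * x ^+ m.+1 * 1 + rx ^+ m.+1 * A)).
  { apply: lerD; rewrite ler_wpM2l// ?mulr_ge0 ?(ltW k0) ?(ltW x0') ?(ltW r0)//.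
    { by rewrite exprn_ile1// ltW. }
    by apply: Hd0 => //; rewrite mulr_gt0. }
  by rewrite /A mulr1 mulrCA mulfV ?gt_eqF// mulr1 subrKC. }
have p2 : c <= psi m kappa h rx x v2.
{ have /(ler_wpM2l (ltW r0)) := HD _ v2q; rewrite mulrCA mulfV ?gt_eqF// mulr1 => H.
  apply: (le_trans H); rewrite /psi lerDr.
  by apply: mulr_ge0; [apply: mulr_ge0; [|apply: exprn_ge0]|apply: exprn_ge0]; exact: ltW. }
have cpsi (v : R) : 0 < v -> {for v, continuous (psi m kappa h rx x)}.
{ move=> v0; apply: cvgD; apply: cvgM; try exact: cvg_cst; first exact: exprn_continuous.
  have hcv := hc _ (mulr_gt0 v0 q0).
  apply: (@continuous_comp _ _ _ (fun v : R => v * q) h^`()%classic v _ hcv).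
  by apply: cvgM; [exact: cvg_id|exact: cvg_cst]. }
have [||v vI E] := @IVT R (psi m kappa h rx x) v1 v2 c v12.
{ apply: continuous_in_subspaceT => v; rewrite inE /= in_itv /= => /andP[vv _].
  by apply: cpsi; exact: lt_le_trans vv. }
{ by rewrite ge_min p1 le_max p2 orbT. }
exists v => //; apply: (lt_le_trans v10).
by move: vI; rewrite in_itv /= => /andP[].
Qed.

Section main.
Variables (m : nat) (kappa : R) (h : R -> R).
Hypothesis kappa_gt0 : 0 < kappa.
Hypothesis h_ge0 : forall d : R, 0 < d -> 0 <= h d.
Hypothesis h_derivable : forall d : R, 0 < d -> derivable h d 1.
Hypothesis h'_continuous : forall d : R, 0 < d -> {for d, continuous h^`()}.
Hypothesis h'_derivable : forall d : R, 0 < d -> derivable h^`() d 1.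
Hypothesis h''_gt0 : forall d : R, 0 < d -> 0 < h^`(2) d.
Hypothesis h'_0 : h^`()%classic d @[d --> 0^'+] --> -oo.
Hypothesis h'_oo : h^`()%classic d @[d --> +oo] --> +oo.
Variables (lam : R) (r : R -> R).
Hypothesis lam_gt0 : 0 < lam.
Hypothesis r_min : minimizer (Ihat m.+2 kappa h lam) (admissible lam) r.
Variables (K gamma0 : R).
Hypotheses (K0 : 0 < K) (gamma00 : 0 < gamma0).
Hypothesis h_growth : forall d c : R, 0 < d -> 0 < c -> `|c - 1| <= gamma0 ->
       `|d * h^`()%classic (c * d)| <= K * (h d + 1).

(** [gam] is the continuous slope and U = C + int_0^x b is the integrated right-hand side. The
    logarithmic part of dL/dr' stands on the right because it does not involve the slope, and the
    derivative of U is dL/dr at slope [gam]. *)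
Lemma local_regularity (a : R) : 0 < a < 1 ->
  exists (gam U : R -> R), forall x, a < x < 1 ->
   [/\ 0 < r x, 0 < gam x, is_derive x (1 : R) r (gam x),
       psi m kappa h (r x) x (gam x) = U x - kappa * m.+1%:R * (r x ^+ m.+1 * (m.+2%:R^-1 + ln
         (r x / x))) &
       is_derive x (1 : R) U
         (m.+1%:R * (r x ^+ m * gam x * h^`()%classic (gam x * (r x / x) ^+ m.+1)
           + kappa * m.+1%:R * (r x ^+ m * gam x * (m.+2%:R^-1 + ln (r x / x))))
          + kappa * m.+1%:R * (r x ^+ m * gam x))].
Proof.
move=> a01; have [a0 a1] := andP a01.
have [adm rm] := r_min; have [_ r1 _ r0] := adm.
have [g [gi g_ge0 g_gt0 wg rE]] := admissible_representation adm.
have [b [C [bi bE ae]]] := Euler_Lagrange_ae kappa_gt0 h_ge0 h_derivable h'_continuous lam_gt0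
  gi g_ge0 g_gt0 rE r0 r1 wg rm K0 gamma00 h_growth a01.
have rc := radial_continuous gi rE.
have x01 x : a < x < 1 -> 0 < x < 1.
{ by move=> /andP[ax ->]; rewrite (lt_trans a0). }
have rp x : a < x < 1 -> 0 < r x.
{ by move=> /x01; exact: (radial_gt0_oo gi g_ge0 g_gt0 rE r0). }
have rcx x : a < x < 1 -> {for x, continuous r}.
{ by move=> /x01 xI; exact: (within_interior_continuous rc xI). }
pose W := prim b.
have Wc : {within `[0, 1], continuous W} by exact: prim_continuous.
have Wcx x : a < x < 1 -> {for x, continuous W}.
{ by move=> /x01 xI; exact: (within_interior_continuous Wc xI). }
pose L x := m.+2%:R^-1 + ln (r x / x).
pose V x := (W x + C) - kappa * m.+1%:R * (r x ^+ m.+1 * L x).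
have qc x : a < x < 1 -> {for x, continuous (fun y => r y / y)}.
{ move=> xI; have /andP[x0 _] := x01 _ xI; apply: cvgM; first exact: rcx.
  by apply: cvgV; [rewrite gt_eqF|exact: cvg_id]. }
have q0 x : a < x < 1 -> 0 < r x / x.
{ by move=> xI; rewrite divr_gt0 ?rp//; case/andP: (x01 _ xI). }
have powc (f : R -> R) x k : {for x, continuous f} -> {for x, continuous (fun y => f y ^+ k)}.
{ by move=> fc; apply: (@continuous_comp _ _ _ f (fun y : R => y ^+ k)) => //; exact:
  exprn_continuous. }
have qXc x : a < x < 1 -> {for x, continuous (fun y => (r y / y) ^+ m.+1)}.
{ by move=> xI; exact: (powc (fun y => r y / y) x m.+1 (qc x xI)). }
have Lc x : a < x < 1 -> {for x, continuous L}.
{ move=> xI; apply: cvgD; first exact: cvg_cst.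
  apply: (@continuous_comp _ _ _ (fun y => r y / y) (@ln R)); first exact: qc.
  apply: continuous_ln; exact: q0. }
have Vc x : a < x < 1 -> {for x, continuous V}.
{ move=> xI; apply: cvgB; first by apply: cvgD; [exact: Wcx|exact: cvg_cst].
  apply: cvgM; first exact: cvg_cst.
  by apply: cvgM; [apply: powc; exact: rcx|exact: Lc]. }
pose k x v := psi m kappa h (r x) x v - V x.
have [||| gam gamP] := @monotone_root_continuous R k a 1.
{ move=> x v xI v0; apply: cvgB; last exact: Vc.
  apply: cvgD.
  { apply: cvgM; last exact: cvg_cst; apply: cvgM; first exact: cvg_cst.
    exact: exprn_continuous. }
  apply: cvgM; first by apply: powc; exact: rcx.
  apply: (@continuous_comp _ _ _ (fun y => v * (r y / y) ^+ m.+1) h^`()%classic).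
  { by apply: cvgM; [exact: cvg_cst|exact: qXc]. }
  by apply: h'_continuous; rewrite mulr_gt0// exprn_gt0// q0. }
{ move=> x u v xI u0 uv; rewrite /k ltrD2r; apply: psi_lt => //; first exact: rp.
  by case/andP: (x01 _ xI). }
{ move=> x xI; have /andP[x0 _] := x01 _ xI.
  have [v v0 E] := psi_root m (V x) kappa_gt0 h'_continuous h'_0 h'_oo (rp _ xI) x0.
  by exists v => //; rewrite /k E subrr. }
(* Dividing the integrated equation by g > 0 shows that g solves the same scalar equation as [gam];
   strict monotonicity makes the root unique. *)
have ggam : {ae mu, forall y, a < y < 1 -> g y = gam y}.
{ apply: (ae_imply ae) => y Ey yI; have /andP[y0 y1] := x01 _ yI.
  have gy := g_gt0 _ (x01 _ yI); have ry := rp _ yI.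
  have [gamy kgam _] := gamP _ yI.
  have kg : k y (g y) = 0.
  { have E := Ey yI; rewrite -/W in E.
    have E2 : slope_coef m kappa h r g y = (kappa * y ^+ m.+1 * g y ^+ m.+1 + r y ^+ m.+1 *
      h^`()%classic (g y * (r y / y) ^+ m.+1)
       + kappa * m.+1%:R * (r y ^+ m.+1 * L y)) * g y.
    { transitivity (kappa * y ^+ m.+1 * g y ^+ m.+2 + (y ^+ m.+1 * det_of m r g y) *
      h^`()%classic (det_of m r g y)
        + kappa * m.+1%:R * ((y ^+ m.+1 * det_of m r g y) * L y)).
      { rewrite /slope_coef /stress_term /grad_term /log_term -/(L y); have : m.+2%:R != 0 :> R
        by rewrite pnatr_eq0.
        by move: (m.+2%:R : R) => nn nn0; field. }
      by rewrite Xn_det_ofE// /det_of [g y ^+ m.+2]exprS; ring. }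
    move: E; rewrite E2 => /(mulIf (lt0r_neq0 gy)); rewrite /k /psi /V => <-; ring. }
  case: (ltrgtP (g y) (gam y)) => // lt1.
  { have := @psi_lt m kappa h (r y) y _ _ kappa_gt0 h'_derivable h''_gt0 ry y0 gy lt1.
    by rewrite -(ltrD2r (- V y)) -/(k y (g y)) -/(k y (gam y)) kg kgam ltxx. }
  have := @psi_lt m kappa h (r y) y _ _ kappa_gt0 h'_derivable h''_gt0 ry y0 gamy lt1.
  by rewrite -(ltrD2r (- V y)) -/(k y (g y)) -/(k y (gam y)) kg kgam ltxx. }
(* The continuous representative of b, obtained by putting [gam] for g in dL/dr; it makes the
   primitive of b differentiable everywhere on (a,1). *)
pose beta x := m.+1%:R * (r x ^+ m * gam x * h^`()%classic (gam x * (r x / x) ^+ m.+1)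
           + kappa * m.+1%:R * (r x ^+ m * gam x * L x))
          + kappa * m.+1%:R * (r x ^+ m * gam x).
have gamc y : a < y < 1 -> {for y, continuous gam} by move=> /gamP[].
have betac y : a < y < 1 -> {for y, continuous beta}.
{ move=> yI; have [gy _ gcy] := gamP _ yI.
  have c1 : {for y, continuous (fun x => r x ^+ m * gam x)}.
  { by apply: cvgM => //; apply: powc; exact: rcx. }
  apply: cvgD; apply: cvgM; try exact: cvg_cst; last exact: c1.
  apply: cvgD.
  { apply: cvgM; first exact: c1.
    apply: (@continuous_comp _ _ _ (fun x => gam x * (r x / x) ^+ m.+1) h^`()%classic).
    { by apply: cvgM => //; exact: qXc. }
    by apply: h'_continuous; rewrite mulr_gt0// exprn_gt0// q0. }
  apply: cvgM; first exact: cvg_cst.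
  by apply: cvgM; [exact: c1|exact: Lc]. }
have bbeta : {ae mu, forall y, a < y < 1 -> b y = beta y}.
{ apply: (ae_imply ggam) => y gy yI; rewrite bE// /value_coef /stress_term /log_term -/(L y).
  have /andP[y0 _] := x01 _ yI; have ry := rp _ yI.
  rewrite mulrA !Xn_det_ofE// -[X in X * L y]mulrA Xn_det_ofE// /det_of gy// /beta.
  rewrite [r y ^+ m.+1]exprS; move: (h^`()%classic _) => d.
  by field; rewrite gt_eqF. }
exists gam, (fun x => W x + C) => x xI.
have [gx kgx _] := gamP _ xI; have [x0 x1] := andP (x01 _ xI).
split => //; first exact: rp.
{ have D := is_deriveD (is_derive_cst (r 0) x (1 : R)) (prim_is_derive gi (ltW a0) gamc ggam xI).
  rewrite add0r in D; apply: near_eq_is_derive D; near=> y.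
  have yI : 0 <= y <= 1 by apply/andP; split; apply: ltW; near: y; [exact: lt_nbhsr|exact:
    lt_nbhsl].
  by rewrite [RHS]rE. }
{ by move/eqP: kgx; rewrite /k subr_eq0 => /eqP ->. }
have D := is_deriveD (prim_is_derive bi (ltW a0) betac bbeta xI) (is_derive_cst C x (1 : R)).
by rewrite addr0 in D.
Unshelve. all: by end_near. Qed.

Lemma Euler_Lagrange_solution : EL_solution m.+2 kappa h r.
Proof.
move=> x /andP[x0 x1]; pose a := x / 2.
have a01 : 0 < a < 1 by apply/andP; split; rewrite /a; lra.
have [gam [U H]] := local_regularity a01.
have xI : a < x < 1 by rewrite x1 andbT /a; lra.
have [rx gx rd psix Ud] := H x xI.
have r'E y : a < y < 1 -> r^`()%classic y = gam y.
{ by move=> /H[_ _ [_ <-] _ _]; rewrite derive1E. }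
have rdd : derivable r x 1 by case: rd.
split => //; first by rewrite r'E.
have strE y : radial_stretches m.+2 r y = stretch_row m (r^`()%classic y) (r y / y) by [].
have q0 : 0 < r x / x by rewrite divr_gt0.
(* Near x this equals x^(n-1) Phi_{,1}. Differentiating the subtracted term cancels the logarithm in
   U' and leaves kappa (n-1) r^(n-1) / x, the contribution of the powers of r/x to the right-hand
   side. *)
pose N y := U y - kappa * m.+1%:R * (r y ^+ m.+1 * (m.+2%:R^-1 + ln (r y / y))).
have qd : is_derive x (1 : R) (fun y => r y / y) (gam x / x - r x / x ^+ 2).
{ have := is_deriveM rd (@is_deriveV R id x 1 1 (lt0r_neq0 x0) (is_derive_id x (1:R))).
  move=> D; apply: is_derive_eq D _; rewrite /GRing.scale /=.
  by field; rewrite gt_eqF. }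
have lnd := @is_derive1_comp R (@ln R) (fun y => r y / y) x _ _ (is_derive1_ln q0) qd.
have rXd : is_derive x (1 : R) (fun y => r y ^+ m.+1) (m.+1%:R * r x ^+ m * gam x).
{ rewrite (_ : (fun y => _) = r ^+ m.+1); last by rewrite exprfctE.
  by have := is_deriveX m.+1 rd; rewrite /GRing.scale /=. }
have Nd : is_derive x (1 : R) N (m.+1%:R * (r x ^+ m * gam x * h^`()%classic (gam x * (r x / x)
  ^+ m.+1))
    + kappa * m.+1%:R * (r x ^+ m.+1 / x)).
{ have D := is_deriveB Ud (is_deriveZ (kappa * m.+1%:R) (is_deriveM rXd (is_deriveD
  (is_derive_cst (m.+2%:R^-1 : R) x (1:R)) lnd))).
  apply: is_derive_eq D _; rewrite /GRing.scale /= add0r.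
  rewrite -[(cst _ + _) x]/(m.+2%:R^-1 + ln (r x / x)).
  move: (h^`()%classic _) (ln _) => d l; rewrite exprS.
  by field; rewrite ?pnatr_eq0 ?gt_eqF. }
have D : is_derive x (1 : R) (fun y => y ^+ m.+1 * partial (Phi kappa h) 1 (radial_stretches
  m.+2 r y))
   (m.+1%:R * (r x ^+ m * gam x * h^`()%classic (gam x * (r x / x) ^+ m.+1))
    + kappa * m.+1%:R * (r x ^+ m.+1 / x)).
{ apply: near_eq_is_derive Nd; near=> y.
  have yI : a < y < 1.
  { by apply/andP; split; near: y; [apply: lt_nbhsr; case/andP: xI|exact: lt_nbhsl]. }
  have [ry gy _ psiy _] := H y yI; have y0 : 0 < y by case/andP: yI => ? _; rewrite (lt_trans _
    (_ : a < y))//; case/andP: a01.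
  rewrite /N -psiy strE partial1E ?r'E// ?divr_gt0// /psi mulrDr mulrA [y ^+ _ * kappa]mulrC;
    congr (_ + _).
  rewrite mulrCA mulrC; congr (_ * _).
  by rewrite -exprMn mulrCA mulfV ?mulr1// gt_eqF. }
apply: is_derive_eq D _.
rewrite /= strE partial2E ?r'E//.
have -> : m.+2%:R - 1 = m.+1%:R :> R by rewrite mulrSr addrK.
rewrite [in RHS]mulrDr.
have xm : x ^+ m != 0 by rewrite expf_neq0// gt_eqF.
move: (h^`()%classic _) => d.
rewrite !expr_div_n !exprS; field.
by rewrite xm gt_eqF.
Unshelve. all: by end_near. Qed.

End main.
End classical.

Theorem theorem3p3 (R : realType) (n : nat) (kappa : R) (h : R -> R)
  (hn : n = 2%N \/ n = 3%N)
  (kappa_gt0 : 0 < kappa)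
  (h_ge0 : forall d : R, 0 < d -> 0 <= h d)
  (h_derivable : forall d : R, 0 < d -> derivable h d 1)
  (h'_continuous : forall d : R, 0 < d -> {for d, continuous h^`()})
  (h'_derivable : forall d : R, 0 < d -> derivable h^`() d 1)
  (h''_gt0 : forall d : R, 0 < d -> 0 < h^`(2) d)
  (h_0 : h d @[d --> 0^'+] --> +oo)
  (h_oo : h d / d @[d --> +oo] --> +oo)
  (h'_0 : h^`() d @[d --> 0^'+] --> -oo)
  (h'_oo : h^`() d @[d --> +oo] --> +oo)
  (lam : R) (lam_gt0 : 0 < lam) (r : R -> R)
  (r_min : minimizer (Ihat n kappa h lam) (admissible lam) r)
  (h_growth : exists K gamma0 : R, [/\ 0 < K, 0 < gamma0 &
     forall d c : R, 0 < d -> 0 < c -> `|c - 1| <= gamma0 ->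
       `|d * h^`()%classic (c * d)| <= K * (h d + 1)]) :
  EL_solution n kappa h r.
Proof.
have [K [gamma0 [K0 gamma00 Kh]]] := h_growth.
case: hn => nE; rewrite nE in r_min *; exact: (Euler_Lagrange_solution _ _ _ _ _ _ _ _ lam_gt0
  r_min K0 gamma00 Kh).
Qed.
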